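(* Let $n\in\mathbb{N}\setminus\{0,1\}$ and let $t_1,t_2,T$ be real numbers with $0<t_1<t_2<T$. Let $u\in L^2((0,T)\times(-n,n))$ satisfy $Pu=0$ in $(0,T)\times(-n,n)$ and $\operatorname{supp} u\subset[t_1,t_2]\times(-n,n)$. Let $0<\epsilon<\min(t_1,T-t_2)$. Then there exists $v\in L^2((0,T)\times(-n-1,n+1))$ such that $Pv=0$ in $(0,T)\times(-n-1,n+1)$, $\operatorname{supp} v\subset[t_1-\epsilon,t_2+\epsilon]\times(-n-1,n+1)$, and $$\|v-u\|_{L^2((0,T)\times(-n+1,n-1))}<\epsilon.$$
   Context: $P=\partial_t+\partial_x+\partial_x^3-\partial_x^5$ is the linear Kawahara operator; equations $Pu=0$ on an open set are understood in the sense of distributions on that set. *)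

(* Defs.v *)
From HB Require Import structures.
From mathcomp Require Import all_boot all_order all_algebra.
From mathcomp Require Import all_classical all_reals all_analysis.
Set Implicit Arguments. Unset Strict Implicit. Unset Printing Implicit Defensive.
Import Order.TTheory GRing.Theory Num.Theory.
Import numFieldNormedType.Exports.
Local Open Scope classical_set_scope.
Local Open Scope ring_scope.

Section Kawahara.
Variable R : realType.

(* Lebesgue measure on R^2 = R * R, points written (t, x). *)
Definition leb2 := ((@lebesgue_measure R) \x (@lebesgue_measure R))%E.

Definition orect (a b c d : R) : set (R * R) :=
  [set z | a < z.1 < b /\ c < z.2 < d].

Definition dt (f : R * R -> R) : R * R -> R :=
  fun z => derive1 (fun s => f (s, z.2)) z.1.
Definition dx (f : R * R -> R) : R * R -> R :=
  fun z => derive1 (fun y => f (z.1, y)) z.2.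

Fixpoint pder (s : seq bool) (f : R * R -> R) : R * R -> R :=
  match s with
  | [::] => f
  | b :: s' => (if b then dt else dx) (pder s' f)
  end.

Definition smooth2 (f : R * R -> R) : Prop :=
  forall s : seq bool,
    continuous (pder s f) /\
    (forall z : R * R,
        derivable (fun t => pder s f (t, z.2)) z.1 1 /\
        derivable (fun y => pder s f (z.1, y)) z.2 1).

Definition fsupp (f : R * R -> R) : set (R * R) := closure [set z | f z != 0].

Definition test_fun (Om : set (R * R)) (phi : R * R -> R) : Prop :=
  smooth2 phi /\ compact (fsupp phi) /\ fsupp phi `<=` Om.

(* formal adjoint of P = d_t + d_x + d_x^3 - d_x^5 :
   P^T phi = - d_t phi - d_x phi - d_x^3 phi + d_x^5 phi *)
Definition Padj (phi : R * R -> R) : R * R -> R :=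
  fun z => - dt phi z - dx phi z - dx (dx (dx phi)) z
           + dx (dx (dx (dx (dx phi)))) z.

Definition inL2 (Om : set (R * R)) (u : R * R -> R) : Prop :=
  measurable_fun Om u /\ (\int[leb2]_(z in Om) ((u z) ^+ 2)%:E < +oo)%E.

Definition L2norm (Om : set (R * R)) (u : R * R -> R) : \bar R :=
  ((\int[leb2]_(z in Om) ((u z) ^+ 2)%:E) `^ (2^-1))%E.

(* P u = 0 in the sense of distributions on Om *)
Definition Pzero (Om : set (R * R)) (u : R * R -> R) : Prop :=
  forall phi, test_fun Om phi ->
    (\int[leb2]_(z in Om) (u z * Padj phi z)%:E = 0)%E.

(* supp u (as a distribution on Om) is contained in S: u = 0 a.e. on Om \ S *)
Definition supp_in (Om S : set (R * R)) (u : R * R -> R) : Prop :=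
  {ae leb2, forall z, Om z -> ~ S z -> u z = 0}.

End Kawahara.

(* Main.v *)
From HB Require Import structures.
Require Import Defs.
From mathcomp Require Import all_boot all_order all_algebra.
From mathcomp Require Import all_classical all_reals all_analysis.
From mathcomp Require Import measurable_realfun.
From mathcomp Require Import ring lra zify.
Set Implicit Arguments. Unset Strict Implicit. Unset Printing Implicit Defensive.
Import Order.TTheory GRing.Theory Num.Theory.
Import numFieldNormedType.Exports.
Local Open Scope classical_set_scope.
Local Open Scope ring_scope.

(** Read [P u = 0] as an evolution equation in [x]:
    [d_x^5 u = d_t u + d_x u + d_x^3 u].  Five [x]-derivatives cost one
    [t]-derivative, so if the Cauchy data at [x = 0] are Gevrey of order 2 < 5 in
    time, the Taylor series in [x] converges for all [x].  Let [w] be the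
    convolution of [u] with a compactly supported mollifier that is Gevrey of
    order 2, built from [exp (- 1 / t)].  On the strip where the mollifier fits,
    [w] is a classical solution with Gevrey data, supported in time in a small
    neighbourhood of [[t1, t2]], and it is [L^2]-close to [u].  The Taylor series
    of [w] at [x = 0] is entire in [x], agrees with [w] where [w] is a solution,
    still solves the equation, and vanishes at the times where [w] does: it is
    the required [v]. *)

(** * A compactly supported Gevrey mollifier *)

(** The Gevrey induction needs the equation for [w] at every time on the line [x = 0], also near 0
    and [T], where the mollifier leaves [(0, T)]. The time support of [u] removes this obstacle:
    near both ends [w] and all its derivatives vanish, so the equation holds for all real [t] as
    soon as [|x| < n - del]. Keeping a compact time support rules out an analytic mollifier and
    forces a finite Gevrey order above 1. The Gevrey constant [C] depends on the radius [del], but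
    it enters only the convergence of the series, after [del] is fixed, and never the [L^2] error.
    The series is not differentiated term by term. Its partial sums are polynomials in [x], so
    integration by parts against a test function is exact for them, and both sides pass to the limit
    by dominated convergence. Likewise [w] is differentiated under the integral by integrating a
    uniform quadratic Taylor remainder of the kernel. Bounded Lipschitz functions serve as the dense
    class in [L^2] because their mollification error is explicit: the Lipschitz constant times the
    size of the kernel's support. *)

Section Bump.
Variable R : realType.
Implicit Types (x t d : R) (i j k m : nat).

(** A remainder of size [h ^+ 2] with an explicit constant survives integration in a parameter. This
    gives the derivatives of the convolution, and it settles [flat] at the origin. *)
Lemma is_derive_quadratic (f : R -> R) x l (K : R) :
  (forall h, `|f (x + h) - f x - h * l| <= K * h ^+ 2) -> is_derive x 1 f l.
Proof.
move=> fK.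
have K0 : 0 <= K by have := le_trans (normr_ge0 _) (fK 1); rewrite expr1n mulr1.
have cvgl : h^-1 *: (f (h *: 1 + x) - f x) @[h --> 0^'] --> l.
  apply/cvgrPdist_le => e e0; near=> h.
  have h0 : h != 0 by near: h; exact: nbhs_dnbhs_neq.
  have -> : l - h^-1 *: (f (h *: 1 + x) - f x) =
      - h^-1 * (f (x + h) - f x - h * l).
    by rewrite /GRing.scale/= mulr1 (addrC h); field.
  rewrite normrM normrN normfV ler_pdivrMl ?normr_gt0//.
  apply: (le_trans (fK h)); rewrite -real_normK ?num_real// expr2 mulrCA ler_wpM2l//.
  have hK : `|h| <= e / (K + 1).
    near: h; apply: dnbhs0_le; apply: divr_gt0 => //; lra.
  rewrite (le_trans (ler_wpM2l K0 hK))// mulrA ler_pdivrMr; last lra.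
  nra.
apply: DeriveDef; first by apply/cvg_ex; exists l.
exact: cvg_lim cvgl.
Unshelve. all: by end_near. Qed.

(** One term of the exponential series is at most its sum. This is the origin of the Gevrey order:
    [k] derivatives of [exp (- 1 / t)] create powers of [1 / t] up to [2 * k], hence the factorial
    of [2 * k]. *)
Lemma exprn_mul_expRN_le_fact (y : R) j :
  0 <= y -> y ^+ j * expR (- y) <= j`!%:R.
Proof.
move=> y0; rewrite expRN ler_pdivrMr ?expR_gt0// -ler_pdivrMl ?ltr0n ?fact_gt0//.
case: j => [|j]; first by rewrite expr0 fact0 invr1 mulr1 -expR0 ler_expR.
rewrite mulrC; apply: le_trans (expR_ge1Dxn _ y0); lra.
Qed.

(** The power of [1 / t] is carried as an index so that the family is closed under differentiation,
    up to linear combinations. *)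
Definition flat j t : R :=
  if 0 < t then t^-1 ^+ j * expR (- t^-1) else 0.

Lemma flat_ge0 j t : 0 <= flat j t.
Proof.
rewrite /flat; case: ifPn => // t0.
by rewrite mulr_ge0 ?expR_ge0// exprn_ge0// invr_ge0 ltW.
Qed.

Lemma flat_le j t : flat j t <= j`!%:R.
Proof.
rewrite /flat; case: ifPn => // t0.
by rewrite exprn_mul_expRN_le_fact// invr_ge0 ltW.
Qed.

Lemma flat_le_sqr j t : flat j t <= j.+2`!%:R * t ^+ 2.
Proof.
rewrite /flat; case: ifPn => t0; last by rewrite mulr_ge0// sqr_ge0.
have := @exprn_mul_expRN_le_fact t^-1 j.+2.
rewrite invr_ge0 => /(_ (ltW t0)) H.
rewrite -ler_pdivrMr ?exprn_gt0//; apply: le_trans H.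
by rewrite -exprVn mulrAC -exprD addn2.
Qed.

Lemma is_derive_flat j t :
  is_derive t 1 (flat j) (flat j.+2 t - j%:R * flat j.+1 t).
Proof.
have [t0|t0|->] := ltgtP t 0.
- apply: (@near_eq_is_derive _ _ _ (cst 0)).
    near=> s; rewrite /flat; have -> // : (0 < s) = false.
    by apply/negbTE; rewrite -leNgt; apply/ltW; near: s; exact: lt_nbhsl.
  by rewrite /flat !ltNge !(ltW t0)/= mulr0 subr0; exact: is_derive_cst.
- apply: (@near_eq_is_derive R R R (fun s : R => s^-1 ^+ j * expR (- s^-1))).
    near=> s; rewrite /flat; have -> // : (0 < s) = true.
    by near: s; exact: lt_nbhsr.
  have t1 : t != 0 by rewrite gt_eqF.
  have dV : is_derive t 1 (fun s : R => s^-1) (- t^-2).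
    have := @is_deriveV R id t 1 1 t1 (is_derive_id _ _).
    by rewrite /GRing.scale/= mulr1.
  have dN : is_derive t 1 (fun s : R => - s^-1) (t^-2).
    by have := is_deriveN dV; rewrite opprK.
  have dE : is_derive t 1 (fun s : R => expR (- s^-1)) (t^-2 * expR (- t^-1)).
    have := @is_derive1_comp R expR (fun s => - s^-1) t _ _ (is_derive_expR _) dN.
    by rewrite mulrC.
  have dX : is_derive t 1 (fun s : R => s^-1 ^+ j)
      (j%:R * t^-1 ^+ j.-1 * (- t^-2)).
    have := @is_deriveX R R (fun s : R => s^-1) j t 1 _ dV.
    by rewrite exprfctE.
  apply: (is_derive_eq (is_deriveM dX dE)).
  rewrite /flat t0 /GRing.scale /=.
  case: j {dX} => [|j]; first by rewrite !mul0r mulr0 !expr0; field.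
  by rewrite /= !exprS; field.
(* At the origin, trading two more powers of [1 / t] for [t ^+ 2] in [flat_le_sqr] bounds [flat j]
   quadratically, so its derivative is 0, as the formula predicts. *)
- have := @is_derive_quadratic (flat j) 0 0 j.+2`!%:R.
  rewrite /flat ltxx mulr0 subr0; apply => h.
  rewrite add0r mulr0 !subr0 ger0_norm; last exact: flat_ge0.
  exact: flat_le_sqr.
Unshelve. all: by end_near. Qed.

(* The [k]-th derivative of [flat j].  Treating all [j] at once makes the Gevrey
   bound [flat_der_le] a direct induction on [k]. *)
Fixpoint flat_der k j t : R :=
  if k is k'.+1 then flat_der k' j.+2 t - j%:R * flat_der k' j.+1 t
  else flat j t.

Lemma is_derive_flat_der k j t :
  is_derive t 1 (flat_der k j) (flat_der k.+1 j t).
Proof.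
elim: k j t => [|k IH] j t; first exact: is_derive_flat.
have -> : flat_der k.+1 j = flat_der k j.+2 - j%:R \*: flat_der k j.+1.
  by apply/funext.
exact: is_deriveB.
Qed.

(** The coefficient [j] of the second term is absorbed by the last factor of the larger factorial,
    so both terms of the recursion obey the same bound; the base 2 counts them. *)
Lemma flat_der_le k j t : `|flat_der k j t| <= 2 ^+ k * (2 * k + j)`!%:R.
Proof.
elim: k j t => [|k IH] j t.
  by rewrite expr0 mul1r muln0 add0n ger0_norm ?flat_ge0 ?flat_le.
rewrite /= (le_trans (ler_normB _ _))// normrM normr_nat.
apply: (@le_trans _ _ (2 ^+ k * (2 * k + j.+2)`!%:R +
    j%:R * (2 ^+ k * (2 * k + j.+1)`!%:R))).
  by apply: lerD => //; rewrite ler_wpM2l.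
have -> : (2 * k.+1 + j = 2 * k + j.+2)%N by lia.
rewrite exprS -mulrA mulr2n mulrDl mul1r lerD2l mulrCA ler_wpM2l ?exprn_ge0//.
by rewrite -natrM ler_nat (addnS _ j.+1) (factS (2 * k + j.+1)) leq_mul//; lia.
Qed.

Lemma flat_der0 k j t : t <= 0 -> flat_der k j t = 0.
Proof.
move=> t0; elim: k j => [|k IH] j /=; first by rewrite /flat ltNge t0.
by rewrite !IH mulr0 subr0.
Qed.

(* The [k]-th derivative of [t |-> f^(i) (d + t) * f^(j) (d - t)], [f = flat 0]. *)
Fixpoint bump_der d k i j t : R :=
  if k is k'.+1 then bump_der d k' i.+1 j t - bump_der d k' i j.+1 t
  else flat_der i 0 (d + t) * flat_der j 0 (d - t).

Lemma is_derive_bump_der d k i j t :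
  is_derive t 1 (bump_der d k i j) (bump_der d k.+1 i j t).
Proof.
elim: k i j t => [|k IH] i j t; last first.
  have -> : bump_der d k.+1 i j = bump_der d k i.+1 j - bump_der d k i j.+1.
    by apply/funext.
  exact: is_deriveB.
have d1 : is_derive t 1 (fun s => d + s) 1.
  by have := is_deriveD (is_derive_cst d t 1) (is_derive_id t 1); rewrite add0r.
have d2 : is_derive t 1 (fun s => d - s) (-1).
  by have := is_deriveB (is_derive_cst d t 1) (is_derive_id t 1); rewrite sub0r.
have D1 := @is_derive1_comp R _ _ t _ _ (is_derive_flat_der i 0 (d + t)) d1.
have D2 := @is_derive1_comp R _ _ t _ _ (is_derive_flat_der j 0 (d - t)) d2.
apply: (is_derive_eq (is_deriveM D1 D2)).
by rewrite /GRing.scale /=; ring.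
Qed.

(** With one index per factor, Leibniz's rule is a two-term recursion without binomial coefficients.
    Each step costs a factor 2 for the two terms and another for the raised index, whence [4 ^+ k]
    at [i = j = 0]. The base case merges two factorials, since a binomial coefficient is at least
    1. *)
Lemma bump_der_le d k i j t :
  `|bump_der d k i j t| <= 2 ^+ (2 * k + i + j) * (2 * (k + i + j))`!%:R.
Proof.
elim: k i j t => [|k IH] i j t.
  rewrite /= normrM.
  apply: le_trans (ler_pM _ _ (flat_der_le i 0 _) (flat_der_le j 0 _)) _ => //.
  rewrite muln0 !add0n !addn0 mulrACA -exprD ler_wpM2l ?exprn_ge0//.
  rewrite -natrM ler_nat mulnDr -(@bin_fact (2 * i + 2 * j) (2 * i)) ?leq_addr//.
  by rewrite addKn leq_pmull// bin_gt0 leq_addr.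
rewrite /= (le_trans (ler_normB _ _))// (le_trans (lerD (IH _ _ _) (IH _ _ _)))//.
have -> : (2 * k.+1 + i + j = (2 * k + i.+1 + j).+1)%N by lia.
have -> : (2 * k + i + j.+1 = 2 * k + i.+1 + j)%N by lia.
have -> : (k + i.+1 + j = k.+1 + i + j)%N by lia.
have -> : (k + i + j.+1 = k.+1 + i + j)%N by lia.
by rewrite exprS -mulrA mulr2n mulrDl mul1r.
Qed.

Lemma bump_der0 d k i j t : d <= `|t| -> bump_der d k i j t = 0.
Proof.
move=> dt; elim: k i j => [|k IH] i j /=; last by rewrite !IH subr0.
move: dt; rewrite ler_normr => /orP[dt|dt].
  by rewrite (@flat_der0 j) ?mulr0//; lra.
by rewrite (@flat_der0 i) ?mul0r//; lra.
Qed.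

Lemma continuous_is_derive (f f' : R -> R) :
  (forall x, is_derive x 1 f (f' x)) -> continuous f.
Proof.
move=> df x; apply: differentiable_continuous; apply/derivable1_diffP.
by have [] := df x.
Qed.

Let mu := @lebesgue_measure R.

Lemma bump_mass d : 0 < d ->
  exists2 c : R, 0 < c & (\int[mu]_(t in `[(- d)%R, d]) (bump_der d 0 0 0 t)%:E = c%:E)%E.
Proof.
move=> d0.
have cb : continuous (bump_der d 0 0 0).
  exact: continuous_is_derive (is_derive_bump_der d 0 0 0).
have ib a b : mu.-integrable `[a, b] (EFin \o bump_der d 0 0 0).
  apply: continuous_compact_integrable; first exact: segment_compact.
  exact: continuous_subspaceT.
have bge0 t : 0 <= bump_der d 0 0 0 t by rewrite /= mulr_ge0 ?flat_ge0.
set I := (X in exists2 c : R, _ & X = _).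
exists (fine I); last first.
  by rewrite fineK//; apply: integrable_fin_num (ib _ _) => //.
(* For [|t| <= d / 2] both [d + t] and [d - t] are at least [d / 2], so [b] bounds the bump from
   below there and the mass is positive. *)
set b := expR (- (d / 2)^-1) ^+ 2.
have b0 : 0 < b by rewrite exprn_gt0 ?expR_gt0.
have : (\int[mu]_(t in `[(- (d / 2))%R, (d / 2)%R]) b%:E <= I)%E.
  apply: (@le_trans _ _ (\int[mu]_(t in `[(- (d / 2))%R, (d / 2)%R]) (bump_der d 0 0 0 t)%:E)%E).
    apply: ge0_le_integral => //.
    - by move=> t _; rewrite lee_fin ltW.
    - by have /integrableP[] := ib (- (d / 2)) (d / 2).
    move=> t /=; rewrite in_itv/= => /andP[t1 t2]; rewrite lee_fin /flat.
    have -> : 0 < d + t by lra.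
    have -> : 0 < d - t by lra.
    rewrite !expr0 !mul1r /b expr2.
    apply: ler_pM; rewrite ?expR_ge0// ler_expR lerN2 lef_pV2 ?posrE; lra.
  apply: ge0_subset_integral => //.
  - by have /integrableP[] := ib (- d) d.
  - by move=> t _; rewrite lee_fin.
  - by move=> t /=; rewrite !in_itv/=; lra.
rewrite integral_cst//= lebesgue_measure_itv/= lte_fin.
have -> : - (d / 2) < d / 2 by lra.
rewrite -EFinB -EFinM => H.
rewrite -lte_fin fineK; last by apply: integrable_fin_num (ib _ _).
by apply: lt_le_trans H; rewrite lte_fin mulr_gt0//; lra.
Qed.

(* [rho k] is the [k]-th derivative of the mollifier [rho 0]. *)
Record gevrey_mollifier d (rho : nat -> R -> R) (C : R) : Prop := {
  moll_derive : forall k t, is_derive t 1 (rho k) (rho k.+1 t);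
  moll_bound : forall k t, `|rho k t| <= C * (4 ^+ k * (2 * k)`!%:R);
  moll_ge0 : forall t, 0 <= rho 0%N t;
  moll_out : forall k t, d <= `|t| -> rho k t = 0;
  moll_mass : (\int[mu]_(t in `[(- d)%R, d]) (rho 0%N t)%:E = 1)%E }.

Lemma exists_gevrey_mollifier d : 0 < d ->
  exists rho C, gevrey_mollifier d rho C.
Proof.
move=> d0; have [c c0 cE] := bump_mass d0.
exists (fun k t => c^-1 * bump_der d k 0 0 t), c^-1; split.
- move=> k t; have := @is_deriveZ R R R (bump_der d k 0 0) c^-1 t 1 _
    (is_derive_bump_der d k 0 0 t).
  by [].
- move=> k t; rewrite normrM gtr0_norm ?invr_gt0// ler_pM2l ?invr_gt0//.
  have E4 : (2 : R) ^+ 2 = 4 by ring.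
  by have := bump_der_le d k 0 0 t; rewrite !addn0 exprM E4.
- by move=> t; rewrite pmulr_rge0 ?invr_gt0//= mulr_ge0 ?flat_ge0.
- by move=> k t dt; rewrite bump_der0 ?mulr0.
- under eq_integral do rewrite EFinM.
  rewrite ge0_integralZl//; last 3 first.
  + apply/measurable_EFinP; apply: measurable_funTS.
    apply: continuous_measurable_fun.
    exact: continuous_is_derive (is_derive_bump_der d 0 0 0).
  + by move=> t _; rewrite lee_fin/= mulr_ge0 ?flat_ge0.
  + by rewrite lee_fin invr_ge0 ltW.
  by rewrite [X in (_ * X)%E]cE -EFinM mulVf// gt_eqF.
Qed.

End Bump.

(** * Density of bounded Lipschitz functions in L^2 of a rectangle *)

Section Plane.
Variable R : realType.
Implicit Types (a b c d : R) (f : R * R -> R).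

Lemma orectE a b c d : orect a b c d = `]a, b[%classic `*` `]c, d[%classic.
Proof. by apply/seteqP; split => z /=; rewrite !in_itv. Qed.

Lemma measurable_orect a b c d :
  measurable (orect a b c d : set (measurableTypeR R * measurableTypeR R)).
Proof. by rewrite orectE; apply: measurableX; exact: measurable_itv. Qed.

Lemma leb2_orect_lty a b c d : (leb2 (orect a b c d) < +oo)%E.
Proof.
rewrite orectE /leb2 product_measure1E//=.
rewrite !lebesgue_measure_itv/=.
by do 2 case: ifP => _; rewrite -?EFinB -?EFinM ?mul0e ?mule0 ltry.
Qed.

Lemma sigma_finite_leb2 : sigma_finite setT (@leb2 R).
Proof.
exists (fun n : nat => orect (- n%:R) n%:R (- n%:R) n%:R).
  apply/esym; rewrite -subTset => z _.
  exists (Num.Def.truncn (`|z.1| + `|z.2|)).+1 => //=.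
  have := Num.Theory.truncnS_gt (`|z.1| + `|z.2|); set k := _%:R => kz.
  have /andP[? ?] : - k < z.1 < k.
    by rewrite -ltr_norml; apply: le_lt_trans kz; rewrite lerDl.
  have /andP[? ?] : - k < z.2 < k.
    by rewrite -ltr_norml; apply: le_lt_trans kz; rewrite lerDr.
  by split; apply/andP.
by move=> n; split; [exact: measurable_orect|exact: leb2_orect_lty].
Qed.

HB.instance Definition _ := Measure.on (@leb2 R).
HB.instance Definition _ := Measure_isSigmaFinite.Build _ _ _ (@leb2 R)
  sigma_finite_leb2.

(** Measurability refers to the product of the Borel structures, continuity to the product topology.
    An open set is the union of the countably many squares it contains with rational centre and
    radius [1 / k.+1]. A radius below [e / 2] suffices, since two points of such a square differ by
    less than [e] in each coordinate. *)
Lemma open_measurable2 (O : set (R * R)) : open O ->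
  measurable (O : set (measurableTypeR R * measurableTypeR R)).
Proof.
move=> oO.
pose r (k : nat) : R := k.+1%:R^-1.
pose box (q : nat * rat * rat) : set (R * R) :=
  orect (ratr q.1.2 - r q.1.1) (ratr q.1.2 + r q.1.1)
        (ratr q.2 - r q.1.1) (ratr q.2 + r q.1.1).
have -> : O = \bigcup_q (if `[< box q `<=` O >] then box q else set0).
  apply/seteqP; split => [z Oz|z [q _]]; last first.
    by case: ifPn => // /asboolP + ?; exact.
  have [/= e e0 zeO] : nbhs_ball z O by apply/nbhs_ballP; exact: open_nbhs_nbhs.
  have [k ke] : exists k, r k < e / 2.
    exists (Num.Def.truncn (e / 2)^-1); rewrite /r invf_plt ?posrE//.
      exact: Num.Theory.truncnS_gt.
    by apply: divr_gt0.
  have rk0 : 0 < r k by rewrite invr_gt0.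
  have [q1 /[!in_itv]/= /andP[q1l q1r]] :
    exists q : rat, ratr q \in `]z.1 - r k, z.1 + r k[ by apply: rat_in_itvoo; lra.
  have [q2 /[!in_itv]/= /andP[q2l q2r]] :
    exists q : rat, ratr q \in `]z.2 - r k, z.2 + r k[ by apply: rat_in_itvoo; lra.
  exists (k, q1, q2) => //; case: ifPn => [_|/asboolP nbox].
    by rewrite /box/=; split; apply/andP; split; lra.
  exfalso; apply: nbox => w [/= /andP[w1 w2] /andP[w3 w4]]; apply: zeO.
  split; rewrite /ball/= ltr_norml; apply/andP; split; lra.
apply: countable_bigcupT_measurable => // q; case: ifPn => // _.
exact: measurable_orect.
Qed.

Lemma continuous_measurable2 f (D : set (measurableTypeR R * measurableTypeR R)) :
  continuous f -> measurable_fun D f.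
Proof.
move=> cf; apply: measurable_funTS.
apply: (measurability _ (RGenOpens.measurableE R)) => _ [_ [a [b ->] <-]].
rewrite setTI; apply: open_measurable2.
by apply: open_comp.
Qed.

End Plane.

Lemma cvge0_lt (R : realType) (u : nat -> \bar R) :
  u @ \oo --> 0%E -> forall e : R, 0 < e -> exists n, (u n < e%:E)%E.
Proof.
move=> u0 e e0.
have /u0[n _ un] : nbhs (0%E : \bar R) (fun y => (y < e%:E)%E).
  by apply: open_ereal_lt'; rewrite lte_fin.
by exists n; exact: (un n (leqnn n)).
Qed.

Section Clamp.
Variable R : realType.
Implicit Types M x y : R.

(** Truncation is 1-Lipschitz and fixes [[- M, M]]: it makes an approximant bounded without moving
    it away from a target already bounded by [M]. *)
Definition clamp M x : R := Num.max (- M) (Num.min M x).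

Lemma clampP M x : 0 <= M ->
  [\/ x <= - M /\ clamp M x = - M, - M <= x <= M /\ clamp M x = x
    | M <= x /\ clamp M x = M].
Proof.
move=> M0; rewrite /clamp; case: (leP M x) => h1.
  by constructor 3; split => //; rewrite max_r//; lra.
case: (leP (- M) x) => h2; first by constructor 2; split => //; lra.
by constructor 1; split => //; lra.
Qed.

Lemma clamp_norm_le M x : 0 <= M -> `|clamp M x| <= M.
Proof. by move=> M0; rewrite ler_norml; case: (clampP x M0) => -[h ->]; lra. Qed.

Lemma clamp_id M x : `|x| <= M -> clamp M x = x.
Proof.
move=> xM; have M0 := le_trans (normr_ge0 x) xM; move: xM.
by rewrite ler_norml; case: (clampP x M0) => -[h ->]; lra.
Qed.

Lemma clamp_lipschitz M x y : 0 <= M -> `|clamp M x - clamp M y| <= `|x - y|.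
Proof.
move=> M0; rewrite ler_norml; case: (clampP x M0) => -[h ->];
  case: (clampP y M0) => -[h' ->]; case: (ler0P (x - y)); lra.
Qed.

Lemma clamp_dist_sqr_le M x : 0 <= M -> (x - clamp M x) ^+ 2 <= x ^+ 2.
Proof. by move=> M0; case: (clampP x M0) => -[h ->]; nra. Qed.

Lemma clamp0 M : 0 <= M -> clamp M 0 = 0.
Proof. by move=> M0; apply: clamp_id; rewrite normr0. Qed.

Lemma measurable_clamp d (T : measurableType d) (D : set T) M (f : T -> R) :
  measurable_fun D f -> measurable_fun D (fun z => clamp M (f z)).
Proof.
move=> mf; apply: measurable_maxr; first exact: measurable_cst.
by apply: measurable_minr => //; exact: measurable_cst.
Qed.

End Clamp.

Import HBSimple.

(** * Density of a truncation-stable vector space of functions, finite measure *)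

Section Approximation.
Context d (T : measurableType d) (R : realType).
Variables (mu : {measure set T -> \bar R}) (D : set T).
Hypotheses (mD : measurable D) (finD : (mu D < +oo)%E).
Implicit Types f g h : T -> R.

Definition L1dist f g : \bar R := (\int[mu]_(x in D) `|f x - g x|%:E)%E.

Lemma ge0_le_integral_EFin f g :
  measurable_fun D f -> measurable_fun D g ->
  (forall x, D x -> 0 <= f x <= g x) ->
  (\int[mu]_(x in D) (f x)%:E <= \int[mu]_(x in D) (g x)%:E)%E.
Proof.
move=> mf mg fg; apply: ge0_le_integral => //.
- by move=> x /fg/andP[].
- exact/measurable_EFinP.
- exact/measurable_EFinP.
- by move=> x /fg/andP[].
Qed.

Lemma ge0_integralD_EFin f g :
  measurable_fun D f -> measurable_fun D g ->
  (forall x, D x -> 0 <= f x) -> (forall x, D x -> 0 <= g x) ->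
  (\int[mu]_(x in D) (f x + g x)%:E =
   \int[mu]_(x in D) (f x)%:E + \int[mu]_(x in D) (g x)%:E)%E.
Proof.
move=> mf mg f0 g0; under eq_integral do rewrite EFinD.
by rewrite ge0_integralD//; exact/measurable_EFinP.
Qed.

Lemma ge0_integralZl_real f (k : R) :
  measurable_fun D f -> (forall x, D x -> 0 <= f x) -> 0 <= k ->
  (\int[mu]_(x in D) (k * f x)%:E = k%:E * \int[mu]_(x in D) (f x)%:E)%E.
Proof.
move=> mf f0 k0; under eq_integral do rewrite EFinM.
by rewrite ge0_integralZl//; exact/measurable_EFinP.
Qed.

Lemma le_bounded_integrable f (K : R) : measurable_fun D f ->
  (forall x, D x -> `|f x| <= K) -> mu.-integrable D (EFin \o f).
Proof.
move=> mf fK; apply: measurable_bounded_integrable => //.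
exists K; split; rewrite ?num_real// => k Kk x Dx.
exact: le_trans (fK x Dx) (ltW Kk).
Qed.

Lemma measurable_dist f g : measurable_fun D f -> measurable_fun D g ->
  measurable_fun D (fun x => `|f x - g x|).
Proof.
by move=> mf mg; apply: measurableT_comp => //; exact: measurable_funB.
Qed.

Lemma L1dist_triangle f g h :
  measurable_fun D f -> measurable_fun D g -> measurable_fun D h ->
  (L1dist f h <= L1dist f g + L1dist g h)%E.
Proof.
move=> mf mg mh; rewrite /L1dist -ge0_integralD_EFin//; try exact: measurable_dist.
apply: ge0_le_integral_EFin; first exact: measurable_dist.
  by apply: measurable_funD; exact: measurable_dist.
by move=> x _; rewrite normr_ge0/= ler_distD.
Qed.

Lemma L1distD f g f' g' :
  measurable_fun D f -> measurable_fun D g ->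
  measurable_fun D f' -> measurable_fun D g' ->
  (L1dist (fun x => (f x + g x)%R) (fun x => (f' x + g' x)%R) <=
   L1dist f f' + L1dist g g')%E.
Proof.
move=> mf mg mf' mg'; rewrite /L1dist -ge0_integralD_EFin//; try exact: measurable_dist.
apply: ge0_le_integral_EFin.
- by apply: measurable_dist; exact: measurable_funD.
- by apply: measurable_funD; exact: measurable_dist.
- by move=> x _; rewrite normr_ge0/= opprD addrACA ler_normD.
Qed.

Lemma L1distZ f g (k : R) : measurable_fun D f -> measurable_fun D g ->
  (L1dist (fun x => (k * f x)%R) (fun x => (k * g x)%R) = `|k|%:E * L1dist f g)%E.
Proof.
move=> mf mg; rewrite /L1dist -ge0_integralZl_real//; last exact: measurable_dist.
by apply: eq_integral => x _; rewrite -mulrBr normrM.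
Qed.

Variable L : (T -> R) -> Prop.
Hypothesis Lm : forall g, L g -> measurable_fun D g.
Hypothesis Lcst : forall c, L (cst c).
Hypothesis LD : forall f g, L f -> L g -> L (fun x => f x + g x).
Hypothesis LZ : forall k f, L f -> L (fun x => k * f x).

(** The closure of [L] is taken in [L^1], and [L2_density] passes to [L^2] once, at the end. [L]
    stays abstract because the argument runs twice: with Lipschitz functions on the line, then in
    the plane. *)
Definition approximable f :=
  forall e : R, 0 < e -> exists2 g, L g & (L1dist f g < e%:E)%E.

Lemma approximable_self f : L f -> approximable f.
Proof.
move=> Lf e e0; exists f => //; rewrite /L1dist.
under eq_integral do rewrite subrr normr0.
by rewrite integral0 lte_fin.
Qed.

Lemma approximableD f g : measurable_fun D f -> measurable_fun D g ->
  approximable f -> approximable g -> approximable (fun x => f x + g x).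
Proof.
move=> mf mg af ag e e0; have e20 : 0 < e / 2 by rewrite divr_gt0.
have [f' Lf' ff'] := af _ e20; have [g' Lg' gg'] := ag _ e20.
exists (fun x => f' x + g' x); first exact: LD.
apply: (le_lt_trans (L1distD mf mg (Lm Lf') (Lm Lg'))).
by rewrite (splitr e) EFinD lteD.
Qed.

Lemma approximableZ f (k : R) : measurable_fun D f ->
  approximable f -> approximable (fun x => k * f x).
Proof.
move=> mf af e e0; have k0 : 0 < `|k| + 1 by rewrite ltr_wpDl.
have [f' Lf' ff'] := af _ (divr_gt0 e0 k0).
exists (fun x => k * f' x); first exact: LZ.
rewrite L1distZ//; last exact: Lm.
apply: (@le_lt_trans _ _ ((`|k| + 1)%:E * L1dist f f')%E).
  by apply: lee_wpmul2r; [exact: integral_ge0|rewrite lee_fin lerDl].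
by rewrite muleC -lte_pdivlMr.
Qed.

Lemma approximable_closed f : measurable_fun D f ->
  (forall e : R, 0 < e ->
    exists g, [/\ measurable_fun D g, approximable g & (L1dist f g < e%:E)%E]) ->
  approximable f.
Proof.
move=> mf H e e0; have e20 : 0 < e / 2 by rewrite divr_gt0.
have [g [mg ag fg]] := H _ e20; have [h Lh gh] := ag _ e20.
exists h => //; apply: (le_lt_trans (L1dist_triangle mf mg (Lm Lh))).
by rewrite (splitr e) EFinD lteD.
Qed.

(** By disjointness the indicator of a finite union is a sum of indicators; the infinite union is an
    [L^1] limit of these by dominated convergence, the measure being finite. *)
Lemma approximable_indic_bigcup (F : (set T)^nat) :
  (forall n, measurable (F n)) -> trivIset setT F ->
  (forall n, approximable (\1_(F n))) -> approximable (\1_(\bigcup_n F n)).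
Proof.
move=> mF tF aF.
pose E n := \big[setU/set0]_(k < n) F k.
have mE n : measurable (E n) by apply: bigsetU_measurable.
have aE n : approximable (\1_(E n)).
  elim: n => [|n IH].
    rewrite /E big_ord0; apply: approximable_self.
    have -> : \1_set0 = cst 0 :> (T -> R) by rewrite indic0.
    exact: Lcst.
  have -> : \1_(E n.+1) = (fun x => \1_(E n) x + \1_(F n) x) :> (T -> R).
    apply/funext => x; rewrite /E big_ord_recr/= -/(E n).
    have : [disjoint E n & F n].
      apply/disj_setPS => y [+ Fy]; rewrite /E -bigcup_mkord => -[k /= kn Fk].
      have kn' := @tF k n I I (ex_intro _ y (conj Fk Fy)).
      by rewrite kn' ltnn in kn.
    rewrite !indicE in_setU; case: (boolP (x \in E n)) => xE; case: (boolP (x \in F n)) => xF;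
      rewrite /= ?addr0 ?add0r// => /disj_setPS /(_ x) H.
    by exfalso; apply: H; split; exact: set_mem.
  by apply: approximableD => //; exact: measurable_indic.
apply: approximable_closed.
  by apply: measurable_indic; exact: bigcup_measurable.
move=> e e0.
have [] := @dominated_convergence _ _ _ mu D mD
   (fun n x => (\1_(E n) x)%:E) (fun x => (\1_(\bigcup_n F n) x)%:E) (cst 1%E).
- by move=> n; apply/measurable_EFinP; exact: measurable_indic.
- by apply/measurable_EFinP; apply: measurable_indic; exact: bigcup_measurable.
- apply: aeW => x _; apply: cvg_near_cst.
  have [[k _ Fkx]|nF] := pselect ((\bigcup_n F n) x).
    near=> n; rewrite !indicE mem_set; last first.
      rewrite /E -bigcup_mkord; exists k => //=; near: n; exact: nbhs_infty_gt.
    by rewrite mem_set//; exists k.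
  near=> n; rewrite !indicE !memNset// /E -bigcup_mkord => -[k _ Fk].
  by apply: nF; exists k.
- by apply: (@le_bounded_integrable (cst 1) 1) => // x _; rewrite normr1.
- apply: aeW => x n _; rewrite /= lee_fin ger0_norm ?indicE//.
  by case: (_ \in _).
move=> _ /cvge0_lt /(_ _ e0) [n /= H] _.
exists (\1_(E n)); split; [exact: measurable_indic|exact: aE|].
rewrite /L1dist; apply: le_lt_trans H; rewrite le_eqVlt; apply/orP; left; apply/eqP.
by apply: eq_integral => x _; rewrite /= distrC.
Unshelve. all: by end_near. Qed.

Hypothesis Lclamp : forall M f, 0 <= M -> L f -> L (fun x => clamp M (f x)).

(** Dynkin's pi-lambda argument: the sets with approximable indicator are stable under complement
    and countable disjoint union, so a generating class stable under intersection suffices. *)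
Lemma approximable_indic (G : set (set T)) :
  @measurable _ T = <<s G >> -> setI_closed G ->
  (forall A, G A -> approximable (\1_A)) ->
  forall A, measurable A -> approximable (\1_A).
Proof.
move=> GE GI GA A; rewrite GE.
apply: (@dynkin_induction _ _ G (fun A => approximable (\1_A))) => //.
- by rewrite indicT; apply: approximable_self; exact: Lcst.
- move=> S mS aS.
  have -> : \1_(~` S) = (fun x => 1 + -1 * \1_S x) :> (T -> R).
    apply/funext => x; rewrite !indicE in_setC.
    by case: (_ \in _); rewrite /=; lra.
  apply: approximableD => //.
  + by apply: measurable_funM; [exact: measurable_cst|exact: measurable_indic].
  + by apply: approximable_self; exact: Lcst.
  + by apply: approximableZ => //; exact: measurable_indic.
- by move=> F mF tF aF; exact: approximable_indic_bigcup.
Qed.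

Hypothesis aI : forall A, measurable A -> approximable (\1_A).

Lemma approximable_sum (I : Type) (s : seq I) (c : I -> R) (A : I -> set T) :
  (forall i, measurable (A i)) ->
  approximable (fun x => \sum_(i <- s) c i * \1_(A i) x).
Proof.
move=> mA.
have mt i : measurable_fun D (fun x => c i * \1_(A i) x).
  by apply: measurable_funM; [exact: measurable_cst|exact: measurable_indic].
elim: s => [|i s IH].
  have -> : (fun x => \sum_(i <- [::]) c i * \1_(A i) x) = cst 0 :> (T -> R).
    by apply/funext => x; rewrite big_nil.
  by apply: approximable_self; exact: Lcst.
have -> : (fun x => \sum_(i <- i :: s) c i * \1_(A i) x) =
    (fun x => c i * \1_(A i) x + \sum_(i <- s) c i * \1_(A i) x).
  by apply/funext => x; rewrite big_cons.
apply: approximableD => //; first exact: measurable_sum.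
by apply: approximableZ; [exact: measurable_indic|exact: aI].
Qed.

Lemma approximable_integrable f :
  mu.-integrable D (EFin \o f) -> approximable f.
Proof.
move=> intf; have mf : measurable_fun D f.
  by apply/measurable_EFinP; have /integrableP[] := intf.
apply: approximable_closed => // e e0.
have [g [ig _ /cvge0_lt/(_ _ e0)[n gn]]] := approximation_sfun_integrable mD intf.
exists (g n); split.
- by apply/measurable_EFinP; have /integrableP[] := ig n.
- have -> : (g n : T -> R) = (fun x => \sum_(y <- finmap.enum_fset (fset_set (range (g n))))
      y * \1_(g n @^-1` [set y]) x).
    by apply/funext => x; rewrite fimfunE fsbig_finite.
  by apply: approximable_sum => y; exact: measurable_sfunP.
- by apply: le_lt_trans gn; rewrite le_eqVlt; apply/orP; left; apply/eqP.
Qed.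

(** First [f] is truncated at a level [n], with small [L^2] error. The truncation is then
    approximated in [L^1], and the approximant is truncated at the same level: between functions
    bounded by [n], the squared distance is at most a constant times the distance. *)
Lemma L2_density f : measurable_fun D f ->
  (\int[mu]_(x in D) (f x ^+ 2)%:E < +oo)%E ->
  forall e : R, 0 < e ->
    exists2 g, L g & (\int[mu]_(x in D) ((f x - g x) ^+ 2)%:E < e%:E)%E.
Proof.
move=> mf f2 e e0.
pose f_ (n : nat) x := clamp n%:R (f x).
have mf_ n : measurable_fun D (f_ n) by exact: measurable_clamp.
have m2 h1 h2 : measurable_fun D h1 -> measurable_fun D h2 ->
    measurable_fun D (fun x => (h1 x - h2 x) ^+ 2).
  by move=> mh1 mh2; apply: measurable_funX; exact: measurable_funB.
have e4 : 0 < e / 4 by rewrite divr_gt0.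
have [n fn] : exists n, (\int[mu]_(x in D) ((f x - f_ n x) ^+ 2)%:E < (e / 4)%:E)%E.
  have [] := @dominated_convergence _ _ _ mu D mD
    (fun n x => ((f x - f_ n x) ^+ 2)%:E) (cst 0%E) (fun x => (f x ^+ 2)%:E).
  - by move=> n; apply/measurable_EFinP; exact: m2.
  - exact: measurable_cst.
  - apply: aeW => x _; apply: cvg_near_cst.
    near=> n; rewrite /f_ clamp_id ?subrr ?expr0n//.
    near: n; exists (Num.Def.truncn `|f x|).+1 => // k /= xk.
    by apply: le_trans (ltW (Num.Theory.truncnS_gt `|f x|)) _; rewrite ler_nat.
  - apply/integrableP; split; first by apply/measurable_EFinP; exact: measurable_funX.
    apply: le_lt_trans f2; rewrite le_eqVlt; apply/orP; left; apply/eqP.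
    by apply: eq_integral => x _; rewrite gee0_abs// lee_fin sqr_ge0.
  - apply: aeW => x n _; rewrite gee0_abs ?lee_fin ?sqr_ge0//.
    exact: clamp_dist_sqr_le.
  by move=> _ _; rewrite integral0 => /cvge0_lt/(_ _ e4).
have intfn : mu.-integrable D (EFin \o f_ n).
  by apply: (@le_bounded_integrable _ n%:R) => // x _; exact: clamp_norm_le.
(* The square of the total error is at most [2 * (f - f_ n) ^+ 2 + 4 * n.+1 * |f_ n - g|]; with this
   choice the two integrals contribute [e / 2] each. *)
have d0 : 0 < e / (8 * n.+1%:R) by rewrite divr_gt0// mulr_gt0.
have [g Lg fg] := approximable_integrable intfn d0.
exists (fun x => clamp n%:R (g x)); first exact: Lclamp.
have mg := measurable_clamp n%:R (Lm Lg).
apply: (@le_lt_trans _ _ (\int[mu]_(x in D)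
  (2 * (f x - f_ n x) ^+ 2 + (4 * n.+1%:R) * `|f_ n x - g x|)%:E)%E).
  apply: ge0_le_integral_EFin; first exact: m2.
    apply: measurable_funD; (apply: measurable_funM; first exact: measurable_cst).
      exact: m2.
    by apply: measurable_dist => //; exact: Lm.
  move=> x _; rewrite sqr_ge0/=.
  set c := clamp _ (g x); set b := f_ n x.
  have cn : `|c| <= n%:R by exact: clamp_norm_le.
  have bn : `|b| <= n%:R by exact: clamp_norm_le.
  have bc : `|b - c| <= `|b - g x|.
    by have := clamp_lipschitz b (g x) (ler0n R n); rewrite (clamp_id bn).
  have bc2 : `|b - c| <= 2 * n.+1%:R.
    by rewrite (le_trans (ler_normB _ _))// -natr1; lra.
  have -> : 4 * n.+1%:R * `|b - g x| = 2 * (2 * n.+1%:R * `|b - g x|) by ring.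
  have H : (b - c) ^+ 2 <= 2 * n.+1%:R * `|b - g x|.
    by rewrite -real_normK ?num_real// expr2 ler_pM.
  have := sqr_ge0 ((f x - b) - (b - c)); nra.
rewrite ge0_integralD_EFin; last 4 first.
- by apply: measurable_funM; [exact: measurable_cst|exact: m2].
- apply: measurable_funM; first exact: measurable_cst.
  by apply: measurable_dist => //; exact: Lm.
- by move=> x _; rewrite mulr_ge0 ?sqr_ge0.
- by move=> x _; rewrite !mulr_ge0.
rewrite ge0_integralZl_real//; [|exact: m2|by move=> x _; exact: sqr_ge0].
rewrite ge0_integralZl_real//; last first.
  by apply: measurable_dist => //; exact: Lm.
apply: (@lt_le_trans _ _ (2%:E * (e / 4)%:E + (4 * n.+1%:R)%:E * (e / (8 * n.+1%:R))%:E)%E).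
  by apply: lteD; rewrite lte_pmul2l.
rewrite -!EFinM -EFinD lee_fin.
have -> : 4 * n.+1%:R * (e / (8 * n.+1%:R)) = e / 2.
  have : n.+1%:R != 0 :> R by rewrite pnatr_eq0.
  by move: (n.+1%:R : R) => N N0; field.
lra.
Unshelve. all: by end_near. Qed.

End Approximation.

Section BoundedLipschitz.
Context d (T : measurableType d) (R : realType) (dist : T -> T -> R).
Hypothesis dist_ge0 : forall x y, 0 <= dist x y.

(** Bounded and Lipschitz with one common constant. Measurability is a separate clause because
    [dist] is an arbitrary function, unrelated to the measurable structure. *)
Definition blip (g : T -> R) := measurable_fun setT g /\
  exists2 K : R, forall x, `|g x| <= K &
    forall x y, `|g x - g y| <= K * dist x y.

Lemma blip_cst c : blip (cst c).
Proof.
split; first exact: measurable_cst.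
by exists `|c| => // x y; rewrite subrr normr0 mulr_ge0.
Qed.

Lemma blipD f g : blip f -> blip g -> blip (fun x => f x + g x).
Proof.
move=> [mf [K fK1 fK2]] [mg [K' gK1 gK2]]; split; first exact: measurable_funD.
exists (K + K') => [x|x y].
  by rewrite (le_trans (ler_normD _ _))// lerD.
by rewrite opprD addrACA mulrDl (le_trans (ler_normD _ _))// lerD.
Qed.

Lemma blipZ k f : blip f -> blip (fun x => k * f x).
Proof.
move=> [mf [K fK1 fK2]]; split.
  by apply: measurable_funM => //; exact: measurable_cst.
exists (`|k| * K) => [x|x y]; first by rewrite normrM ler_wpM2l.
by rewrite -mulrBr normrM -mulrA ler_wpM2l.
Qed.

Lemma blip_clamp M f : 0 <= M -> blip f -> blip (fun x => clamp M (f x)).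
Proof.
move=> M0 [mf [K fK1 fK2]]; split; first exact: measurable_clamp.
exists K => [x|x y]; last exact: le_trans (clamp_lipschitz _ _ M0) (fK2 x y).
have := clamp_lipschitz (f x) 0 M0; rewrite clamp0// !subr0 => h.
exact: le_trans h (fK1 x).
Qed.

End BoundedLipschitz.

(** * Indicators on the line *)

Section RealLine.
Variable R : realType.
Let mu := @lebesgue_measure R.
Local Notation mR := (measurableTypeR R).

Definition dist1 (x y : mR) : R := `|x - y|.

Lemma dist1_ge0 x y : 0 <= dist1 x y. Proof. exact: normr_ge0. Qed.

(** For [k > 0], the piecewise affine function equal to 0 up to [a - 1 / k] and to 1 from [a] on,
    with slope [k] in between. *)
Definition ramp (a k x : R) : R := (1 + clamp 1 (1 + 2 * k * (x - a))) / 2.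

Lemma ramp_ge0_le1 a k x : 0 <= ramp a k x <= 1.
Proof.
by rewrite /ramp; case: (clampP (1 + 2 * k * (x - a)) (@ler01 R)) => -[h ->]; lra.
Qed.

Lemma blip_ramp a k : 0 <= k -> blip dist1 (ramp a k).
Proof.
move=> k0; have lr x y : `|ramp a k x - ramp a k y| <= k * `|x - y|.
  have -> : ramp a k x - ramp a k y =
    (clamp 1 (1 + 2 * k * (x - a)) - clamp 1 (1 + 2 * k * (y - a))) / 2.
    by rewrite /ramp; field.
  rewrite normrM (@ger0_norm _ 2^-1) ?invr_ge0// ler_pdivrMr//.
  apply: (le_trans (clamp_lipschitz _ _ (@ler01 R))).
  have -> : 1 + 2 * k * (x - a) - (1 + 2 * k * (y - a)) = 2 * k * (x - y) by ring.
  by rewrite normrM (@ger0_norm _ (2 * k)) ?mulr_ge0//; lra.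
split.
  apply: measurable_funM; last exact: measurable_cst.
  apply: measurable_funD; first exact: measurable_cst.
  apply: measurable_clamp; apply: measurable_funD; first exact: measurable_cst.
  apply: measurable_funM; first exact: measurable_cst.
  by apply: measurable_funB; [exact: measurable_id|exact: measurable_cst].
exists (1 + k) => [x|x y].
  by have /andP[h1 h2] := ramp_ge0_le1 a k x; rewrite ger0_norm//; lra.
by apply: (le_trans (lr x y)); rewrite /dist1 ler_wpM2r//; lra.
Qed.

(** The closed rays [[a, +oo[] generate the measurable sets and are stable under intersection. At
    each point the ramps are eventually equal to the indicator of the ray, so dominated convergence
    applies. *)
Lemma approximable_indic1 (D A : set mR) : measurable D -> (mu D < +oo)%E ->
  measurable A -> approximable mu D (blip dist1) (\1_A).
Proof.
move=> mD fD; apply: (@approximable_indic _ _ _ mu D mD fD (blip dist1) _ _ _ _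
    (@RGenCInfty.G R)).
- by move=> g [mg _]; exact: measurable_funTS.
- exact: blip_cst dist1_ge0.
- exact: blipD.
- exact: blipZ.
- exact: RGenCInfty.measurableE.
- move=> _ _ [a ->] [b ->]; exists (Num.max a b).
  by apply/seteqP; split => x /=; rewrite !in_itv/= !andbT ge_max => /andP.
move=> _ [a ->] e e0.
have [] := @dominated_convergence _ _ _ mu D mD
   (fun n x => (ramp a n%:R x)%:E) (fun x => (\1_(`[a, +oo[%classic) x)%:E) (cst 1%E).
- move=> n; apply/measurable_EFinP; apply: measurable_funTS.
  by have [] := @blip_ramp a n%:R (ler0n R n).
- by apply/measurable_EFinP; exact: measurable_indic.
- apply: aeW => x _; apply: cvg_near_cst.
  case: (leP a x) => ax.
    apply: nearW => n; rewrite indicE mem_set/= ?in_itv/= ?ax// /ramp.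
    case: (clampP (1 + 2 * n%:R * (x - a)) (@ler01 R)) => -[h ->]; congr EFin; last lra.
      have : 0 <= n%:R * (x - a) by rewrite mulr_ge0// subr_ge0.
      lra.
    have : 0 <= n%:R * (x - a) by rewrite mulr_ge0// subr_ge0.
    lra.
  exists (Num.Def.truncn (a - x)^-1).+1 => // n /= xn.
  rewrite indicE memNset/= ?in_itv/= ?andbT; last by apply/negP; rewrite -ltNge.
  have : 1 <= n%:R * (a - x).
    rewrite -ler_pdivrMr ?subr_gt0// mul1r.
    apply: le_trans (ltW (Num.Theory.truncnS_gt (a - x)^-1)) _.
    by rewrite ler_nat.
  rewrite /ramp => h'.
  by case: (clampP (1 + 2 * n%:R * (x - a)) (@ler01 R)) => -[h ->]; congr EFin; lra.
- by apply: (@le_bounded_integrable _ _ _ mu D mD fD (cst 1) 1) => // x _; rewrite normr1.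
- apply: aeW => x n _; have /andP[h1 h2] := ramp_ge0_le1 a n%:R x.
  by rewrite /= lee_fin ger0_norm.
move=> _ /cvge0_lt /(_ _ e0) [n /= H] _.
exists (ramp a n%:R); first exact: blip_ramp.
apply: le_lt_trans H; rewrite le_eqVlt; apply/orP; left; apply/eqP.
by apply: eq_integral => x _; rewrite /= distrC.
Qed.

End RealLine.

(** * Iterated integrals and density on rectangles *)

Section PlaneIntegrals.
Variable R : realType.
Let mu := @lebesgue_measure R.
Local Notation mR := (measurableTypeR R).
Implicit Types (a b c d : R) (f : R * R -> R).

Lemma orect_patch a b c d f x :
  (\int[mu]_y ((EFin \o f) \_ (orect a b c d)) (x, y) =
   ((fun x => \int[mu]_(y in `]c, d[) (f (x, y))%:E) \_ `]a, b[) x)%E.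
Proof.
rewrite patchE; case: ifPn => [|] xab.
  rewrite [RHS]integral_mkcond; apply: eq_integral => y _.
  rewrite !patchE; congr (if _ then _ else _); apply/idP/idP.
    by rewrite !inE orectE => -[].
  rewrite !inE => ycd; rewrite orectE; split => //=.
  by move: xab; rewrite inE.
rewrite integral0_eq// => y _; rewrite patchE; case: ifPn => // /set_mem.
by rewrite orectE => -[/= h _]; move: xab; rewrite mem_set.
Qed.

Lemma orect_patch' a b c d f y :
  (\int[mu]_x ((EFin \o f) \_ (orect a b c d)) (x, y) =
   ((fun y => \int[mu]_(x in `]a, b[) (f (x, y))%:E) \_ `]c, d[) y)%E.
Proof.
rewrite patchE; case: ifPn => [|] xab.
  rewrite [RHS]integral_mkcond; apply: eq_integral => x _.
  rewrite !patchE; congr (if _ then _ else _); apply/idP/idP.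
    by rewrite !inE orectE => -[].
  rewrite !inE => ycd; rewrite orectE; split => //=.
  by move: xab; rewrite inE.
rewrite integral0_eq// => x _; rewrite patchE; case: ifPn => // /set_mem.
by rewrite orectE => -[/= _ h]; move: xab; rewrite mem_set.
Qed.

Lemma measurable_patch_orect a b c d f :
  measurable_fun (orect a b c d : set (mR * mR)) f ->
  measurable_fun (setT : set (mR * mR)) ((EFin \o f) \_ (orect a b c d)).
Proof.
move=> mf; apply/(measurable_restrictT _ _).1; first exact: measurable_orect.
exact/measurable_EFinP.
Qed.

Lemma tonelli_orect a b c d f :
  measurable_fun (orect a b c d : set (mR * mR)) f ->
  (forall z, orect a b c d z -> 0 <= f z) ->
  (\int[@leb2 R]_(z in orect a b c d) (f z)%:E =
   \int[mu]_(x in `]a, b[) \int[mu]_(y in `]c, d[) (f (x, y))%:E)%E.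
Proof.
move=> mf f0; rewrite integral_mkcond /leb2.
rewrite (@fubini_tonelli1 _ _ _ _ _ mu mu) /fubini_F; last 2 first.
- exact: measurable_patch_orect.
- by apply: erestrict_ge0 => z /f0.
under eq_integral do rewrite orect_patch.
by rewrite -integral_mkcond.
Qed.

Lemma tonelli_orect' a b c d f :
  measurable_fun (orect a b c d : set (mR * mR)) f ->
  (forall z, orect a b c d z -> 0 <= f z) ->
  (\int[@leb2 R]_(z in orect a b c d) (f z)%:E =
   \int[mu]_(y in `]c, d[) \int[mu]_(x in `]a, b[) (f (x, y))%:E)%E.
Proof.
move=> mf f0; rewrite integral_mkcond /leb2.
rewrite (@fubini_tonelli2 _ _ _ _ _ mu mu) /fubini_G; last 2 first.
- exact: measurable_patch_orect.
- by apply: erestrict_ge0 => z /f0.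
under eq_integral do rewrite orect_patch'.
by rewrite -integral_mkcond.
Qed.

Definition dist2 (z w : mR * mR) : R := `|z.1 - w.1| + `|z.2 - w.2|.

Lemma dist2_ge0 z w : 0 <= dist2 z w. Proof. exact: addr_ge0. Qed.

Lemma blip_prod (h1 h2 : mR -> R) : blip (@dist1 R) h1 -> blip (@dist1 R) h2 ->
  blip dist2 (fun z => h1 z.1 * h2 z.2).
Proof.
move=> [m1 [K1 b1 l1]] [m2 [K2 b2 l2]]; split.
  by apply: measurable_funM; apply: measurableT_comp.
exists (K1 * K2) => [z|z w].
  by rewrite normrM ler_pM.
have -> : h1 z.1 * h2 z.2 - h1 w.1 * h2 w.2 =
  (h1 z.1 - h1 w.1) * h2 z.2 + h1 w.1 * (h2 z.2 - h2 w.2) by ring.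
rewrite /dist2 [leRHS]mulrDr (le_trans (ler_normD _ _))//; apply: lerD.
  by rewrite normrM mulrAC ler_pM.
by rewrite normrM -mulrA ler_pM.
Qed.

(** Measurable rectangles generate the product structure, so it is enough to approximate
    [\1_A * \1_B]. Truncating the one-dimensional approximants to [[-1, 1]] bounds the error of the
    product by the sum of the two errors. *)
Lemma L2_density_orect a b c d f :
  measurable_fun (orect a b c d : set (mR * mR)) f ->
  (\int[@leb2 R]_(z in orect a b c d) (f z ^+ 2)%:E < +oo)%E ->
  forall e : R, 0 < e -> exists2 g, blip dist2 g &
    (\int[@leb2 R]_(z in orect a b c d) ((f z - g z) ^+ 2)%:E < e%:E)%E.
Proof.
have mO := @measurable_orect R a b c d.
have fO := @leb2_orect_lty R a b c d.
have Lm g : blip dist2 g -> measurable_fun (orect a b c d : set (mR * mR)) g.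
  by move=> [mg _]; exact: measurable_funTS.
apply: (L2_density mO fO Lm (blip_cst dist2_ge0) (@blipD _ _ _ dist2)
  (@blipZ _ _ _ dist2) (@blip_clamp _ _ _ dist2)).
apply: (approximable_indic mO fO Lm (blip_cst dist2_ge0) (@blipD _ _ _ dist2)
  (@blipZ _ _ _ dist2) (measurable_prod_measurableType _ _)).
  move=> _ _ [A1 mA1 [B1 mB1 <-]] [A2 mA2 [B2 mB2 <-]].
  exists (A1 `&` A2); first exact: measurableI.
  by exists (B1 `&` B2); [exact: measurableI|rewrite setXI].
move=> _ [A mA [B mB <-]] e e0.
have fI p q : (mu `]p, q[%classic < +oo)%E.
  by rewrite /mu lebesgue_measure_itv/=; case: ifP; rewrite // -EFinB ltry.
(* Integrating a one-variable error over the rectangle multiplies it by the length of the other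
   side; [S] exceeds both lengths and is positive. *)
pose S := `|b - a| + `|d - c| + 1.
have S0 : 0 < S by rewrite /S ltr_wpDl ?addr_ge0.
have e20 : 0 < e / 2 / S by rewrite !divr_gt0.
have mI p q : measurable (`]p, q[%classic : set mR) by exact: measurable_itv.
have [h1 Lh1 Ah1] := approximable_indic1 (mI a b) (fI a b) mA e20.
have [h2 Lh2 Bh2] := approximable_indic1 (mI c d) (fI c d) mB e20.
have mp (h : mR -> R) (C : set mR) : measurable_fun setT h -> measurable C ->
    measurable_fun setT (fun x => `|\1_C x - h x|).
  move=> mh mC; apply: measurableT_comp => //.
  by apply: measurable_funB => //; exact: measurable_indic.
pose k1 x := clamp 1 (h1 x); pose k2 x := clamp 1 (h2 x).
have Lk1 : blip (@dist1 R) k1 by exact: blip_clamp.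
have Lk2 : blip (@dist1 R) k2 by exact: blip_clamp.
exists (fun z => k1 z.1 * k2 z.2); first exact: blip_prod.
have mF1 : measurable_fun setT (fun z : mR * mR => `|\1_A z.1 - h1 z.1|).
  by apply: (measurableT_comp (mp _ _ Lh1.1 mA)).
have mF2 : measurable_fun setT (fun z : mR * mR => `|\1_B z.2 - h2 z.2|).
  by apply: (measurableT_comp (mp _ _ Lh2.1 mB)).
have len p q : (mu `]p, q[%classic <= `|q - p|%:E)%E.
  rewrite /mu lebesgue_measure_itv/=; case: ifP => _; last by rewrite lee_fin.
  by rewrite -EFinB lee_fin ler_norm.
have bound (h : mR -> R) (C : set mR) p q p' q' : measurable_fun setT h -> measurable C ->
    (L1dist mu `]p, q[ \1_C h < (e / 2 / S)%:E)%E -> `|q' - p'| + 1 <= S ->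
    (\int[mu]_(y in `]p', q'[) \int[mu]_(x in `]p, q[) `|\1_C x - h x|%:E < (e / 2)%:E)%E.
  move=> mh mC H HS.
  have v0 : (0 <= L1dist mu `]p, q[ \1_C h)%E by apply: integral_ge0.
  have vE : L1dist mu `]p, q[ \1_C h = (fine (L1dist mu `]p, q[ \1_C h))%:E.
    by rewrite fineK// ge0_fin_numE// (lt_trans H) ?ltry.
  move: v0 H; rewrite -/(L1dist mu `]p, q[ \1_C h) vE.
  move: (fine _) => r; rewrite lee_fin lte_fin => r0 H.
  rewrite integral_cst//; apply: (@le_lt_trans _ _ (r%:E * S%:E)%E).
    apply: lee_wpmul2l; first by rewrite lee_fin.
    by apply: (le_trans (len p' q')); rewrite lee_fin; lra.
  by rewrite -EFinM lte_fin -ltr_pdivlMr.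
apply: (@le_lt_trans _ _ (\int[@leb2 R]_(z in orect a b c d)
   (`|\1_A z.1 - h1 z.1| + `|\1_B z.2 - h2 z.2|)%:E)%E).
  apply: ge0_le_integral_EFin => //.
  - apply: measurable_dist; last by apply: Lm; exact: blip_prod.
    by apply: measurable_indic; exact: measurableX.
  - by apply: measurable_funTS; exact: measurable_funD.
  move=> z _; rewrite normr_ge0/=.
  have -> : \1_(A `*` B) z = \1_A z.1 * \1_B z.2 :> R.
    by rewrite !indicE in_setX; case: (_ \in A); case: (_ \in B); rewrite /= ?mulr0 ?mulr1.
  have I1 (C : set mR) x : `|\1_C x : R| <= 1.
    by rewrite indicE; case: (_ \in _); rewrite /= ?normr0 ?normr1.
  have ck (C : set mR) (h : mR -> R) x : `|\1_C x - clamp 1 (h x)| <= `|\1_C x - h x|.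
    by have := clamp_lipschitz (\1_C x) (h x) (@ler01 R); rewrite (clamp_id (I1 _ _)).
  have -> : \1_A z.1 * \1_B z.2 - k1 z.1 * k2 z.2 =
      (\1_A z.1 - k1 z.1) * \1_B z.2 + k1 z.1 * (\1_B z.2 - k2 z.2) by ring.
  rewrite (le_trans (ler_normD _ _))//; apply: lerD; rewrite normrM.
    by rewrite -[leRHS]mulr1 ler_pM// ck.
  by rewrite -[leRHS]mul1r ler_pM// ?ck// clamp_norm_le.
rewrite ge0_integralD_EFin//; try by apply: measurable_funTS.
rewrite (splitr e) EFinD; apply: lteD.
  rewrite tonelli_orect'//=; last by apply: measurable_funTS.
  by apply: bound => //; [exact: Lh1.1|rewrite /S lerD2r ?lerDr].
rewrite tonelli_orect//=; last by apply: measurable_funTS.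
by apply: bound => //; [exact: Lh2.1|rewrite /S lerD2r ?lerDl].
Qed.

End PlaneIntegrals.

(** * Schur test for integral operators *)

Section Pairing.
Context d (T : measurableType d) (R : realType).
Variables (mu : {measure set T -> \bar R}) (D : set T).
Hypotheses (mD : measurable D) (finD : (mu D < +oo)%E).
Implicit Types u psi : T -> R.

Definition pairing u psi : R := \int[mu]_(w in D) (u w * psi w).

Lemma integrable_L2 u : measurable_fun D u ->
  (\int[mu]_(x in D) (u x ^+ 2)%:E < +oo)%E -> mu.-integrable D (EFin \o u).
Proof.
move=> mu_ u2.
have i1 : mu.-integrable D (EFin \o (fun x => 1 + u x ^+ 2)).
  apply/integrableP; split.
    apply/measurable_EFinP; apply: measurable_funD; first exact: measurable_cst.
    exact: measurable_funX.
  under eq_integral do rewrite /= ger0_norm ?addr_ge0 ?sqr_ge0//.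
  rewrite ge0_integralD_EFin//; last by move=> x _; exact: sqr_ge0.
    rewrite integral_cst// mul1e; apply: lte_add_pinfty => //.
  exact: measurable_funX.
apply: le_integrable i1 => //; first exact/measurable_EFinP.
move=> x _ /=; rewrite lee_fin [leRHS]ger0_norm ?addr_ge0 ?sqr_ge0//.
rewrite -real_normK ?num_real//.
have := sqr_ge0 (`|u x| - 1); have := normr_ge0 (u x); nra.
Qed.

Lemma integrable_pairing u psi (K : R) : mu.-integrable D (EFin \o u) ->
  measurable_fun D psi -> (forall w, D w -> `|psi w| <= K) ->
  mu.-integrable D (EFin \o (fun w => u w * psi w)).
Proof.
move=> iu mp pK; have mu_ : measurable_fun D u.
  by apply/measurable_EFinP; have /integrableP[] := iu.
apply: (@le_integrable _ _ _ mu D mD _ (EFin \o (fun w => `|K| * u w))).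
- by apply/measurable_EFinP; exact: measurable_funM.
- move=> w Dw /=; rewrite lee_fin !normrM normr_id mulrC ler_wpM2r//.
  exact: le_trans (pK w Dw) (ler_norm K).
- rewrite /comp; under eq_fun do rewrite EFinM.
  exact: integrableZl.
Qed.

Lemma norm_pairing_le u psi (K : R) : mu.-integrable D (EFin \o u) ->
  measurable_fun D psi -> (forall w, D w -> `|psi w| <= K) ->
  `|pairing u psi| <= K * \int[mu]_(w in D) `|u w|.
Proof.
move=> iu mp pK.
have ip := integrable_pairing iu mp pK.
apply: (le_trans (le_normr_Rintegral mD ip)).
have ia := integrable_norm iu.
rewrite -RintegralZl//; apply: le_Rintegral => //.
- exact: integrable_norm.
- rewrite /comp; under eq_fun do rewrite EFinM.
  exact: integrableZl.
- by move=> w Dw; rewrite normrM mulrC ler_wpM2r// pK.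
Qed.

Lemma pairingB u psi1 psi2 (K : R) : mu.-integrable D (EFin \o u) ->
  measurable_fun D psi1 -> measurable_fun D psi2 ->
  (forall w, D w -> `|psi1 w| <= K) -> (forall w, D w -> `|psi2 w| <= K) ->
  pairing u (fun w => psi1 w - psi2 w) = pairing u psi1 - pairing u psi2.
Proof.
move=> iu m1 m2 K1 K2; rewrite /pairing -RintegralB//.
- by apply: eq_Rintegral => w _; rewrite mulrBr.
- exact: integrable_pairing K1.
- exact: integrable_pairing K2.
Qed.

(* Jensen's inequality for the sub-probability density [psi]. *)
Lemma sqr_pairing_le u psi (K : R) : measurable_fun D u ->
  (\int[mu]_(x in D) (u x ^+ 2)%:E < +oo)%E ->
  measurable_fun D psi -> (forall w, D w -> 0 <= psi w <= K) ->
  (\int[mu]_(w in D) (psi w)%:E <= 1)%E ->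
  ((pairing u psi ^+ 2)%:E <= \int[mu]_(w in D) (psi w * u w ^+ 2)%:E)%E.
Proof.
move=> mu_ u2 mp p0K p1.
have iu := integrable_L2 mu_ u2.
have pK w : D w -> `|psi w| <= K.
  by move=> /p0K/andP[p0 pK]; rewrite ger0_norm.
have iu2 : mu.-integrable D (EFin \o (fun x => u x ^+ 2)).
  apply/integrableP; split; first by apply/measurable_EFinP; exact: measurable_funX.
  by under eq_integral do rewrite /= ger0_norm ?sqr_ge0//.
have ip : mu.-integrable D (EFin \o psi) by exact: le_bounded_integrable pK.
have iup := integrable_pairing iu mp pK.
have iu2p : mu.-integrable D (EFin \o (fun w => u w ^+ 2 * psi w)).
  exact: integrable_pairing iu2 mp pK.
set c := pairing u psi.
have E : (\int[mu]_(w in D) (psi w * u w ^+ 2)%:E)%E =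
    (\int[mu]_(w in D) (u w ^+ 2 * psi w))%:E.
  rewrite /Rintegral fineK; first by apply: eq_integral => w _; rewrite mulrC.
  exact: integrable_fin_num iu2p.
rewrite E lee_fin.
have p1' : \int[mu]_(w in D) psi w <= 1.
  rewrite -lee_fin /Rintegral fineK//; exact: integrable_fin_num ip.
have iZ (k : R) h : mu.-integrable D (EFin \o h) ->
    mu.-integrable D (EFin \o (fun w => k * h w)).
  by move=> ih; rewrite /comp; under eq_fun do rewrite EFinM; exact: integrableZl.
have : 0 <= \int[mu]_(w in D) (u w ^+ 2 * psi w - (2 * c) * (u w * psi w) +
   c ^+ 2 * psi w).
  apply: Rintegral_ge0 => w /p0K/andP[p0 _].
  have -> : u w ^+ 2 * psi w - 2 * c * (u w * psi w) + c ^+ 2 * psi w =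
    (u w - c) ^+ 2 * psi w by ring.
  by rewrite mulr_ge0 ?sqr_ge0.
rewrite RintegralD//; last 2 first.
- rewrite /comp; under eq_fun do rewrite EFinB.
  by apply: integrableB => //; exact: iZ.
- exact: iZ.
rewrite RintegralB//; last exact: iZ.
rewrite !RintegralZl// -/(pairing u psi) -/c.
by have := sqr_ge0 c; nra.
Qed.

End Pairing.

Section Schur.
Context d (T : measurableType d) (R : realType).
Variable mu : {sigma_finite_measure set T -> \bar R}.
Variables (D D' : set T).
Hypotheses (mD : measurable D) (mD' : measurable D') (finD : (mu D < +oo)%E).
Variables (K : T * T -> R) (B : R).
Hypothesis mK : measurable_fun setT K.
Hypothesis K0 : forall z w, 0 <= K (z, w) <= B.
Hypothesis K1 : forall z, (\int[mu]_(w in D) (K (z, w))%:E <= 1)%E.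
Hypothesis K2 : forall w, (\int[mu]_(z in D') (K (z, w))%:E <= 1)%E.

(** Jensen's inequality for the density [K (z, _)] of mass at most 1 bounds [c z ^+ 2] by an average
    of [u ^+ 2]. After exchanging the integrals, the other mass bound on [K (_, w)] leaves the
    integral of [u ^+ 2]. *)
Lemma Schur_test (u : T -> R) : measurable_fun D u ->
  (\int[mu]_(x in D) (u x ^+ 2)%:E < +oo)%E ->
  let c z := pairing mu D u (fun w => K (z, w)) in
  measurable_fun D' c ->
  (\int[mu]_(z in D') (c z ^+ 2)%:E <= \int[mu]_(w in D) (u w ^+ 2)%:E)%E.
Proof.
move=> mu_ u2 c mc.
pose r2 : T -> R := (fun w => u w ^+ 2) \_ D.
have mr2 : measurable_fun setT r2.
  by apply/(measurable_restrictT _ _).1 => //; exact: measurable_funX.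
have r20 w : 0 <= r2 w by rewrite /r2 patchE; case: ifP => // _; exact: sqr_ge0.
pose F (p : T * T) : \bar R := (\1_D' p.1 * K p * r2 p.2)%:E.
have mKz z : measurable_fun setT (fun w => K (z, w)).
  by apply: (measurableT_comp mK).
have mKw w : measurable_fun setT (fun z => K (z, w)).
  by apply: (measurableT_comp mK).
have mF : measurable_fun setT F.
  apply/measurable_EFinP; apply: measurable_funM.
    apply: measurable_funM => //.
    by apply: (measurableT_comp (@measurable_indic _ _ R setT D' mD')).
  by apply: (measurableT_comp mr2).
have F0 p : (0 <= F p)%E.
  rewrite lee_fin !mulr_ge0// ?indicE//.
  by case: p => z w; have /andP[] := K0 z w.
have r2E : (\int[mu]_(w in D) (u w ^+ 2)%:E)%E = (\int[mu]_w (r2 w)%:E)%E.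
  rewrite integral_mkcond; apply: eq_integral => w _.
  by rewrite /r2 !patchE; case: ifP.
rewrite r2E integral_mkcond.
apply: (@le_trans _ _ (\int[mu]_z \int[mu]_w F (z, w))%E).
  apply: ge0_le_integral => //.
  - by move=> z _; apply: erestrict_ge0 => ? _; rewrite lee_fin sqr_ge0.
  - apply/(measurable_restrictT _ _).1 => //; apply/measurable_EFinP.
    exact: measurable_funX.
  - exact: measurable_fun_fubini_tonelli_F.
  move=> z _; rewrite patchE; case: ifPn => [zD'|_]; last exact: integral_ge0.
  apply: le_trans (@sqr_pairing_le _ _ _ mu D mD finD u (fun w => K (z, w)) B mu_ u2
    (measurable_funTS (mKz z)) (fun w _ => K0 z w) (K1 z)) _.
  rewrite integral_mkcond le_eqVlt; apply/orP; left; apply/eqP.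
  apply: eq_integral => w _; rewrite /F /r2 !patchE/= indicE zD' mul1r.
  by case: ifP => _ //; rewrite mulr0.
rewrite fubini_tonelli//; apply: ge0_le_integral => //.
- by move=> w _; exact: integral_ge0.
- exact: measurable_fun_fubini_tonelli_G.
- exact/measurable_EFinP.
move=> w _.
have -> : (\int[mu]_z F (z, w) = (r2 w)%:E * \int[mu]_(z in D') (K (z, w))%:E)%E.
  rewrite [in RHS]integral_mkcond -ge0_integralZl//.
  - apply: eq_integral => z _; rewrite /F patchE indicE/=.
    by case: ifP => _; rewrite /= ?mul1r ?mul0r ?mule0// EFinM muleC.
  - apply/(measurable_restrictT _ _).1 => //; apply/measurable_EFinP.
    exact: measurable_funTS.
  - move=> z _; apply: erestrict_ge0 => y _; rewrite lee_fin.
    by have /andP[] := K0 y w.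
  - by rewrite lee_fin.
by rewrite -[leRHS]mule1; apply: lee_wpmul2l => //; rewrite lee_fin.
Qed.

End Schur.

(** * L^2-convergence of mollification *)

Section LipschitzFacts.
Variable R : realType.
Implicit Types x y : R.

Lemma is_derive_lipschitz (f f' : R -> R) (K : R) :
  (forall x, is_derive x 1 f (f' x)) -> (forall x, `|f' x| <= K) ->
  forall x y, `|f x - f y| <= K * `|x - y|.
Proof.
move=> df fK x y.
wlog xy : x y / y <= x.
  by move=> H; have [/H//|/ltW/H] := leP y x; rewrite distrC (distrC y).
have cf : {within `[y, x], continuous f}.
  exact/continuous_subspaceT/(continuous_is_derive df).
have [c _ ->] := MVT_segment xy (fun z _ => df z) cf.
by rewrite normrM ler_wpM2r.
Qed.

Lemma dist2_lipschitz_continuous (f : R * R -> R) (K : R) :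
  (forall z w, `|f z - f w| <= K * dist2 z w) -> continuous f.
Proof.
move=> fK z.
have K1 : 0 < `|K| + 1 by rewrite ltr_wpDl.
apply/cvgrPdist_lt => e e0.
have r0 : 0 < e / (2 * (`|K| + 1)) by rewrite divr_gt0// mulr_gt0.
have : nbhs (z : R * R) (ball (z : R * R) (e / (2 * (`|K| + 1)))).
  by apply/nbhs_ballP; exists (e / (2 * (`|K| + 1))).
apply: filterS => w [/= h1 h2]; apply: (le_lt_trans (fK z w)).
have H : dist2 z w < e / (`|K| + 1).
  have -> : e / (`|K| + 1) = e / (2 * (`|K| + 1)) + e / (2 * (`|K| + 1)).
    by field; rewrite gt_eqF.
  by rewrite /dist2 ltrD.
apply: (@le_lt_trans _ _ ((`|K| + 1) * dist2 z w)).
  by rewrite ler_wpM2r ?dist2_ge0// (le_trans (ler_norm K))// lerDl.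
by rewrite mulrC -ltr_pdivlMr.
Qed.

End LipschitzFacts.

Section Mollification.
Variable R : realType.
Local Notation mR := (measurableTypeR R).
Let mu := @lebesgue_measure R.
Variables (del : R) (rho : nat -> R -> R) (C : R).
Hypothesis del0 : 0 < del.
Hypothesis moll : gevrey_mollifier del rho C.
Implicit Types (k m : nat) (z w : R * R) (x y s t : R).

Definition mbound k : R := C * (4 ^+ k * (2 * k)`!%:R).

Lemma rho_le k t : `|rho k t| <= mbound k.
Proof. exact: moll_bound moll k t. Qed.

Lemma mbound_ge0 k : 0 <= mbound k.
Proof. exact: le_trans (normr_ge0 _) (rho_le k 0). Qed.

Lemma rho_lipschitz k x y : `|rho k x - rho k y| <= mbound k.+1 * `|x - y|.
Proof. exact: (is_derive_lipschitz (moll_derive moll k) (rho_le k.+1)). Qed.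

Lemma rho_continuous k : continuous (rho k).
Proof. exact: continuous_is_derive (moll_derive moll k). Qed.

Lemma rho_measurable k : measurable_fun setT (rho k : mR -> R).
Proof. by apply: continuous_measurable_fun; exact: rho_continuous. Qed.

(** Read in two ways: in [z] it is the kernel whose convolution is differentiated, in [w] it is the
    test function inserted in [Pzero]. *)
Definition ker k m z w : R := rho k (z.1 - w.1) * rho m (z.2 - w.2).

Lemma ker_le k m z w : `|ker k m z w| <= mbound k * mbound m.
Proof. by rewrite normrM ler_pM// rho_le. Qed.

Lemma measurable_ker2 k m :
  measurable_fun setT (fun p : (mR * mR) * (mR * mR) => ker k m p.1 p.2).
Proof.
apply: measurable_funM; (apply: (measurableT_comp (rho_measurable _));
  apply: measurable_funB; apply: measurableT_comp => //).
Qed.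

Lemma measurable_ker k m z (D : set (mR * mR)) :
  measurable_fun D (ker k m z : mR * mR -> R).
Proof.
apply: measurable_funTS; apply: measurable_funM;
  (apply: (measurableT_comp (rho_measurable _)); apply: measurable_funB => //).
Qed.

Lemma ker_lipschitz k m z z' w :
  `|ker k m z w - ker k m z' w| <=
    (mbound k.+1 * mbound m + mbound k * mbound m.+1) * dist2 z z'.
Proof.
have -> : ker k m z w - ker k m z' w =
  (rho k (z.1 - w.1) - rho k (z'.1 - w.1)) * rho m (z.2 - w.2) +
  rho k (z'.1 - w.1) * (rho m (z.2 - w.2) - rho m (z'.2 - w.2)).
  by rewrite /ker; ring.
rewrite (le_trans (ler_normD _ _))// [leRHS]mulrDl; apply: lerD; rewrite normrM.
  rewrite mulrAC ler_pM ?rho_le//.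
  apply: (le_trans (rho_lipschitz _ _ _)).
  have -> : z.1 - w.1 - (z'.1 - w.1) = z.1 - z'.1 by ring.
  by rewrite ler_wpM2l ?mbound_ge0// /dist2 lerDl.
rewrite -mulrA ler_pM ?rho_le//.
apply: (le_trans (rho_lipschitz _ _ _)).
have -> : z.2 - w.2 - (z'.2 - w.2) = z.2 - z'.2 by ring.
by rewrite ler_wpM2l ?mbound_ge0// /dist2 lerDr.
Qed.

Lemma derive1_affine (F : R -> R) (l : R) :
  (forall x, is_derive x 1 F l) -> derive1 F = cst l.
Proof. by move=> dF; apply/funext => x; rewrite derive1E; apply: derive_val. Qed.

Lemma is_derive_subl (t s : R) : is_derive s 1 (fun s => t - s) (-1).
Proof.
by have := is_deriveB (is_derive_cst t s 1) (is_derive_id s 1); rewrite sub0r.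
Qed.

Lemma is_derive_subr (t s : R) : is_derive t 1 (fun t => t - s) 1.
Proof.
by have := is_deriveB (is_derive_id t 1) (is_derive_cst s t 1); rewrite subr0.
Qed.

Lemma is_derive_oo_LR (F F' : R -> R) (p q : R) :
  (forall x, is_derive x 1 F (F' x)) -> derivable_oo_LRcontinuous F p q.
Proof.
move=> dF; have cF := continuous_is_derive dF; split.
- by move=> x _; have [] := dF x.
- exact: cvg_at_right_filter (cF p).
- exact: cvg_at_left_filter (cF q).
Qed.

Lemma rho_mass_subl t :
  (\int[mu]_(s in `[(t - del)%R, (t + del)%R]) (rho 0 (t - s))%:E = 1)%E.
Proof.
have h : t - del <= t + del by have := del0; lra.
have dF s := is_derive_subl t s; have dE := derive1_affine dF.
have := @integration_by_substitution_decreasing R (fun s => t - s) (rho 0)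
  (t - del) (t + del).
rewrite dE.
have -> : t - (t + del) = - del by ring.
have -> : t - (t - del) = del by ring.
rewrite (moll_mass moll) => H; apply/esym; rewrite {}H; last 7 first.
- exact: h.
- by move=> x y _ _ /= xy; lra.
- by move=> x _; exact: cst_continuous.
- exact: is_cvg_cst.
- exact: is_cvg_cst.
- exact: (is_derive_oo_LR _ _ dF).
- exact/continuous_subspaceT/rho_continuous.
by apply: eq_integral => s _; rewrite fctE /= opprK mulr1.
Qed.

Lemma rho_mass_subr s :
  (\int[mu]_(t in `[(s - del)%R, (s + del)%R]) (rho 0 (t - s))%:E = 1)%E.
Proof.
have h : s - del <= s + del by have := del0; lra.
have dF t := is_derive_subr t s; have dE := derive1_affine dF.
have := @integration_by_substitution_increasing R (fun t => t - s) (rho 0)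
  (s - del) (s + del).
rewrite dE.
have -> : s - del - s = - del by ring.
have -> : s + del - s = del by ring.
rewrite (moll_mass moll) => H; apply/esym; rewrite {}H; last 7 first.
- exact: h.
- by move=> x y _ _ /= xy; lra.
- by move=> x _; exact: cst_continuous.
- exact: is_cvg_cst.
- exact: is_cvg_cst.
- exact: (is_derive_oo_LR _ _ dF).
- exact/continuous_subspaceT/rho_continuous.
by apply: eq_integral => t _; rewrite fctE /= mulr1.
Qed.

Lemma mass_restrict_le (f : R -> R) (p : R) (I : set mR) :
  measurable I -> measurable_fun setT (f : mR -> R) -> (forall s, 0 <= f s) ->
  (forall s, del <= `|s - p| -> f s = 0) ->
  (\int[mu]_(s in `[(p - del)%R, (p + del)%R]) (f s)%:E = 1)%E ->
  (\int[mu]_(s in I) (f s)%:E <= 1)%E.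
Proof.
move=> mI mf f0 fout <-.
have mf' (J : set mR) : measurable J -> measurable_fun setT ((EFin \o f) \_ J).
  move=> mJ; apply/(measurable_restrictT _ _).1 => //.
  by apply/measurable_EFinP; exact: measurable_funTS.
rewrite integral_mkcond [leRHS]integral_mkcond; apply: ge0_le_integral => //.
- by move=> s _; apply: erestrict_ge0 => ? _; rewrite lee_fin.
- exact: mf'.
- exact: mf'.
move=> s _; rewrite !patchE; case: ifPn => _; case: ifPn => //= sp.
  rewrite fout// leNgt; apply: contra sp; rewrite ltr_norml => /andP[h1 h2].
  by rewrite inE/= in_itv/=; lra.
by rewrite lee_fin.
Qed.

Lemma mass_restrict_eq (f : R -> R) (p : R) (I : set mR) :
  (forall s, del <= `|s - p| -> f s = 0) ->
  (\int[mu]_(s in `[(p - del)%R, (p + del)%R]) (f s)%:E = 1)%E ->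
  `[p - del, p + del] `<=` I -> (\int[mu]_(s in I) (f s)%:E = 1)%E.
Proof.
move=> fout <- pI.
rewrite integral_mkcond [RHS]integral_mkcond; apply: eq_integral => s _.
rewrite !patchE; case: ifPn => sI; case: ifPn => //= sp.
  rewrite fout// leNgt; apply: contra sp; rewrite ltr_norml => /andP[h1 h2].
  by rewrite inE/= in_itv/=; lra.
by move: sI; rewrite mem_set//; apply: pI; exact: set_mem.
Qed.

Lemma measurable_rho_subl t : measurable_fun setT (fun s : mR => rho 0 (t - s)).
Proof. by apply: (measurableT_comp (rho_measurable 0)); exact: measurable_funB. Qed.

Lemma measurable_rho_subr s : measurable_fun setT (fun t : mR => rho 0 (t - s)).
Proof. by apply: (measurableT_comp (rho_measurable 0)); exact: measurable_funB. Qed.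

Lemma rho_subl_out t s : del <= `|s - t| -> rho 0 (t - s) = 0.
Proof. by rewrite distrC => h; exact: moll_out moll _ _ h. Qed.

Lemma rho_subr_out t s : del <= `|s - t| -> rho 0 (s - t) = 0.
Proof. exact: moll_out moll _ _. Qed.

Variables (a b c d : R).
Let Om : set (mR * mR) := orect a b c d.

Lemma ker_massE (f g : R -> R) a' b' c' d' :
  measurable_fun setT (f : mR -> R) -> measurable_fun setT (g : mR -> R) ->
  (forall s, 0 <= f s) -> (forall s, 0 <= g s) ->
  (\int[@leb2 R]_(w in orect a' b' c' d') (f w.1 * g w.2)%:E =
   \int[mu]_(x in `]a', b'[) ((f x)%:E * \int[mu]_(y in `]c', d'[) (g y)%:E))%E.
Proof.
move=> mf mg f0 g0; rewrite tonelli_orect//=; first last.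
- by move=> z _; rewrite mulr_ge0.
- apply: measurable_funTS; apply: measurable_funM.
    by apply: (measurableT_comp mf).
  by apply: (measurableT_comp mg).
apply: eq_integral => x _; rewrite -ge0_integralZl//; last 2 first.
- by move=> y _; rewrite lee_fin.
- by rewrite lee_fin.
by apply/measurable_EFinP; exact: measurable_funTS.
Qed.

Lemma ker_mass_le (f g : R -> R) a' b' c' d' :
  measurable_fun setT (f : mR -> R) -> measurable_fun setT (g : mR -> R) ->
  (forall s, 0 <= f s) -> (forall s, 0 <= g s) ->
  (\int[mu]_(x in `]a', b'[) (f x)%:E <= 1)%E ->
  (\int[mu]_(x in `]c', d'[) (g x)%:E <= 1)%E ->
  (\int[@leb2 R]_(w in orect a' b' c' d') (f w.1 * g w.2)%:E <= 1)%E.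
Proof.
move=> mf mg f0 g0 f1 g1; rewrite ker_massE//.
apply: le_trans f1; apply: ge0_le_integral => //.
- move=> x _; rewrite mule_ge0 ?lee_fin//; apply: integral_ge0 => y _.
  by rewrite lee_fin.
- apply: emeasurable_funM; last exact: measurable_cst.
  by apply/measurable_EFinP; exact: measurable_funTS.
- by apply/measurable_EFinP; exact: measurable_funTS.
- by move=> x _; rewrite -[leRHS]mule1; apply: lee_wpmul2l; rewrite ?lee_fin.
Qed.

Lemma ker_mass_w z : (\int[@leb2 R]_(w in Om) (ker 0 0 z w)%:E <= 1)%E.
Proof.
apply: (@ker_mass_le (fun s => rho 0 (z.1 - s)) (fun s => rho 0 (z.2 - s))).
- exact: measurable_rho_subl.
- exact: measurable_rho_subl.
- by move=> s; exact: moll_ge0 moll _.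
- by move=> s; exact: moll_ge0 moll _.
- apply: (@mass_restrict_le _ z.1) => //; first exact: measurable_rho_subl.
  + by move=> s; exact: moll_ge0 moll _.
  + exact: rho_subl_out.
  + exact: rho_mass_subl.
- apply: (@mass_restrict_le _ z.2) => //; first exact: measurable_rho_subl.
  + by move=> s; exact: moll_ge0 moll _.
  + exact: rho_subl_out.
  + exact: rho_mass_subl.
Qed.

Lemma ker_mass_z w a' b' c' d' :
  (\int[@leb2 R]_(z in orect a' b' c' d') (ker 0 0 z w)%:E <= 1)%E.
Proof.
apply: (@ker_mass_le (fun s => rho 0 (s - w.1)) (fun s => rho 0 (s - w.2))).
- exact: measurable_rho_subr.
- exact: measurable_rho_subr.
- by move=> s; exact: moll_ge0 moll _.
- by move=> s; exact: moll_ge0 moll _.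
- apply: (@mass_restrict_le _ w.1) => //; first exact: measurable_rho_subr.
  + by move=> s; exact: moll_ge0 moll _.
  + exact: rho_subr_out.
  + exact: rho_mass_subr.
- apply: (@mass_restrict_le _ w.2) => //; first exact: measurable_rho_subr.
  + by move=> s; exact: moll_ge0 moll _.
  + exact: rho_subr_out.
  + exact: rho_mass_subr.
Qed.

Let Om' : set (mR * mR) := orect (a + del) (b - del) (c + del) (d - del).

(** [Om'] is [Om] shrunk by [del] on every side, so the support of the kernel in [w] lies inside
    [Om] and no mass is lost. *)
Lemma ker_mass_interior z : Om' z ->
  (\int[@leb2 R]_(w in Om) (ker 0 0 z w)%:E = 1)%E.
Proof.
move=> [/= /andP[z1 z2] /andP[z3 z4]].
rewrite /Om (@ker_massE (fun s => rho 0 (z.1 - s)) (fun s => rho 0 (z.2 - s))).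
- rewrite (@mass_restrict_eq (fun s => rho 0 (z.2 - s)) z.2).
  + under eq_integral do rewrite mule1.
    apply: (@mass_restrict_eq _ z.1); [exact: rho_subl_out|exact: rho_mass_subl|].
    by move=> s /=; rewrite !in_itv/=; lra.
  + exact: rho_subl_out.
  + exact: rho_mass_subl.
  + by move=> s /=; rewrite !in_itv/=; lra.
- exact: measurable_rho_subl.
- exact: measurable_rho_subl.
- by move=> s; exact: moll_ge0 moll _.
- by move=> s; exact: moll_ge0 moll _.
Qed.

(* [k] derivatives in [t] and [m] derivatives in [x] of the mollification of [u]. *)
Definition mollify (u : R * R -> R) k m z : R := pairing (@leb2 R) Om u (ker k m z).

Lemma mollify_lipschitz (u : R * R -> R) k m : (@leb2 R).-integrable Om (EFin \o u) ->
  exists K, forall z z', `|mollify u k m z - mollify u k m z'| <= K * dist2 z z'.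
Proof.
move=> iu; exists ((mbound k.+1 * mbound m + mbound k * mbound m.+1) *
  \int[@leb2 R]_(w in Om) `|u w|) => z z'.
have mO : measurable Om by exact: measurable_orect.
have -> : mollify u k m z - mollify u k m z' =
    pairing (@leb2 R) Om u (fun w => ker k m z w - ker k m z' w).
  apply/esym; apply: (@pairingB _ _ _ (@leb2 R) Om mO u _ _ (mbound k * mbound m)) => //.
  - exact: measurable_ker.
  - exact: measurable_ker.
  - by move=> w _; exact: ker_le.
  - by move=> w _; exact: ker_le.
rewrite mulrAC; apply: norm_pairing_le => //.
  by apply: measurable_funB; exact: measurable_ker.
by move=> w _; exact: ker_lipschitz.
Qed.

Lemma measurable_mollify (u : R * R -> R) k m (D : set (mR * mR)) :
  (@leb2 R).-integrable Om (EFin \o u) -> measurable_fun D (mollify u k m).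
Proof.
move=> iu; apply: continuous_measurable2.
have [K uK] := mollify_lipschitz k m iu.
exact: dist2_lipschitz_continuous uK.
Qed.

(** Since the kernel has mass 1, the error is an average of [g w - g z], over points [w] within
    [del] of [z] in each coordinate; hence [2 * del] for [dist2]. *)
Lemma mollify_lipschitz_le (g : R * R -> R) (K : R) : blip (@dist2 R) g ->
  (forall z w, `|g z - g w| <= K * dist2 z w) -> 0 <= K ->
  forall z, Om' z -> `|mollify g 0 0 z - g z| <= K * (2 * del).
Proof.
move=> [mg [B gB _]] gK K0 z zOm.
have mO : measurable Om by exact: measurable_orect.
have fO : (@leb2 R Om < +oo)%E by exact: leb2_orect_lty.
have mgO : measurable_fun Om g by exact: measurable_funTS.
have ig : (@leb2 R).-integrable Om (EFin \o g).
  by apply: (@le_bounded_integrable _ _ _ (@leb2 R) Om mO fO g B) => // w _.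
have mk : measurable_fun Om (ker 0 0 z) by exact: measurable_ker.
have kB w : Om w -> `|ker 0 0 z w| <= mbound 0 * mbound 0 by move=> _; exact: ker_le.
have k0 w : 0 <= ker 0 0 z w by rewrite mulr_ge0// (moll_ge0 moll).
have ik : (@leb2 R).-integrable Om (EFin \o ker 0 0 z).
  exact: (@le_bounded_integrable _ _ _ (@leb2 R) Om mO fO _ _ mk kB).
have k1 : \int[@leb2 R]_(w in Om) ker 0 0 z w = 1.
  by rewrite /Rintegral ker_mass_interior.
have igk := integrable_pairing mO ig mk kB.
have iZ (e : R) : (@leb2 R).-integrable Om (EFin \o (fun w => e * ker 0 0 z w)).
  by rewrite /comp; under eq_fun do rewrite EFinM; exact: integrableZl.
have -> : mollify g 0 0 z - g z = \int[@leb2 R]_(w in Om) ((g w - g z) * ker 0 0 z w).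
  rewrite -[X in _ - X]mulr1 -k1 -RintegralZl// -RintegralB//.
  by apply: eq_Rintegral => w _; rewrite mulrBl.
have iB : (@leb2 R).-integrable Om (EFin \o (fun w => (g w - g z) * ker 0 0 z w)).
  apply: (integrable_pairing mO _ mk kB); rewrite /comp.
  under eq_fun do rewrite EFinB.
  apply: integrableB => //.
  by apply: (@le_bounded_integrable _ _ _ (@leb2 R) Om mO fO (cst (g z)) `|g z|) => // w _.
apply: (le_trans (le_normr_Rintegral mO iB)).
move LE : (K * (2 * del)) => L.
rewrite -[leRHS]mulr1 -k1 -RintegralZl//; apply: le_Rintegral => //.
  exact: integrable_norm.
move=> w Ow; rewrite normrM (ger0_norm (k0 w)).
have [kw|kw] := eqVneq (ker 0 0 z w) 0; first by rewrite kw !mulr0.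
rewrite ler_wpM2r// distrC (le_trans (gK z w))// -LE ler_wpM2l//.
have h1 : `|z.1 - w.1| < del.
  rewrite ltNge; apply: contra kw => h; rewrite /ker (moll_out moll) ?mul0r//.
have h2 : `|z.2 - w.2| < del.
  rewrite ltNge; apply: contra kw => h; rewrite /ker [X in _ * X](moll_out moll) ?mulr0//.
have -> : 2 * del = del + del by ring.
by rewrite /dist2 lerD// ltW.
Qed.

(** With [r = u - g], the error is the mollification of [r], minus [r], plus the error for [g]. The
    square of a sum of three terms is at most 3 times the sum of the squares; by the Schur test the
    two terms in [r] each cost [3 * A]. *)
Lemma mollify_error_le (u g : R * R -> R) (K A : R) :
  measurable_fun (Om : set (mR * mR)) u ->
  (\int[@leb2 R]_(z in Om) (u z ^+ 2)%:E < +oo)%E ->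
  blip (@dist2 R) g -> (forall z w, `|g z - g w| <= K * dist2 z w) -> 0 <= K ->
  (\int[@leb2 R]_(z in Om) ((u z - g z) ^+ 2)%:E <= A%:E)%E ->
  (\int[@leb2 R]_(z in Om') ((mollify u 0 0 z - u z) ^+ 2)%:E <=
    (6 * A)%:E + (3 * (K * (2 * del)) ^+ 2)%:E * @leb2 R Om)%E.
Proof.
move=> mu_ u2 Lg gK K0 uA.
have mO : measurable Om by exact: measurable_orect.
have mO' : measurable Om' by exact: measurable_orect.
have fO : (@leb2 R Om < +oo)%E by exact: leb2_orect_lty.
have [mg [B gB _]] := Lg.
have sub : Om' `<=` Om.
  by move=> z [/= /andP[h1 h2] /andP[h3 h4]]; have := del0; split; apply/andP; split; lra.
have mgO : measurable_fun Om g by exact: measurable_funTS.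
pose r z := u z - g z.
have mr : measurable_fun Om r by exact: measurable_funB.
have r2 : (\int[@leb2 R]_(z in Om) (r z ^+ 2)%:E < +oo)%E.
  by apply: le_lt_trans uA _; rewrite ltry.
have ir : (@leb2 R).-integrable Om (EFin \o r) by exact: integrable_L2.
have iu : (@leb2 R).-integrable Om (EFin \o u) by exact: integrable_L2.
have ig : (@leb2 R).-integrable Om (EFin \o g).
  by apply: (@le_bounded_integrable _ _ _ (@leb2 R) Om mO fO g B) => // w _.
have convr z : mollify u 0 0 z = mollify r 0 0 z + mollify g 0 0 z.
  have mk : measurable_fun Om (ker 0 0 z) by exact: measurable_ker.
  have kB w : Om w -> `|ker 0 0 z w| <= mbound 0 * mbound 0.
    by move=> _; exact: ker_le.
  have igk := integrable_pairing mO ig mk kB.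
  have irk := integrable_pairing mO ir mk kB.
  rewrite /mollify /pairing -RintegralD//.
  by apply: eq_Rintegral => w _; rewrite -mulrDl /r subrK.
have mcr : measurable_fun Om' (mollify r 0 0) by exact: measurable_mollify.
have mcu : measurable_fun Om' (mollify u 0 0) by exact: measurable_mollify.
have muO' : measurable_fun Om' u by exact: measurable_funS mu_.
have mrO' : measurable_fun Om' r by exact: measurable_funS mr.
have young : (\int[@leb2 R]_(z in Om') (mollify r 0 0 z ^+ 2)%:E <= A%:E)%E.
  apply: le_trans uA.
  apply: (@Schur_test _ _ _ (@leb2 R) Om Om' mO mO' fO
    (fun p => ker 0 0 p.1 p.2) (mbound 0 * mbound 0)) => //.
  - exact: measurable_ker2.
  - move=> z w; rewrite mulr_ge0 ?(moll_ge0 moll)//=.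
    exact: le_trans (ler_norm _) (ker_le 0 0 z w).
  - exact: ker_mass_w.
  - by move=> w; exact: ker_mass_z.
have rO' : (\int[@leb2 R]_(z in Om') (r z ^+ 2)%:E <= A%:E)%E.
  apply: le_trans uA; apply: ge0_subset_integral => //.
    by apply/measurable_EFinP; exact: measurable_funX.
  by move=> z _; rewrite lee_fin sqr_ge0.
set L := K * (2 * del).
apply: (@le_trans _ _ (\int[@leb2 R]_(z in Om')
   (3 * mollify r 0 0 z ^+ 2 + (3 * r z ^+ 2 + 3 * L ^+ 2))%:E)%E).
  apply: ge0_le_integral_EFin => //.
  - by apply: measurable_funX; exact: measurable_funB.
  - apply: measurable_funD.
      by apply: measurable_funM; [exact: measurable_cst|exact: measurable_funX].
    apply: measurable_funD; last exact: measurable_cst.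
    by apply: measurable_funM; [exact: measurable_cst|exact: measurable_funX].
  move=> z Oz; rewrite sqr_ge0/=.
  have := mollify_lipschitz_le Lg gK K0 Oz; rewrite -/L.
  have -> : mollify u 0 0 z - u z = mollify r 0 0 z - r z + (mollify g 0 0 z - g z).
    by rewrite convr /r; ring.
  set p := mollify r 0 0 z; set q := mollify g 0 0 z - g z; set s := r z.
  move=> qL; have : q ^+ 2 <= L ^+ 2.
    rewrite -real_normK ?num_real// ler_sqr ?nnegrE//.
    exact: le_trans (normr_ge0 _) qL.
  have := sqr_ge0 (p + s); have := sqr_ge0 (p - q); have := sqr_ge0 (s + q); nra.
have m3 (h : R * R -> R) : measurable_fun Om' h ->
    measurable_fun Om' (fun z => 3 * h z ^+ 2).
  by move=> mh; apply: measurable_funM; [exact: measurable_cst|exact: measurable_funX].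
have p3 (h : R * R -> R) z : Om' z -> 0 <= 3 * h z ^+ 2.
  by move=> _; rewrite mulr_ge0 ?sqr_ge0.
rewrite ge0_integralD_EFin//; last 4 first.
- exact: m3.
- by apply: measurable_funD; [exact: m3|exact: measurable_cst].
- exact: p3.
- by move=> z Oz; rewrite addr_ge0 ?p3// mulr_ge0 ?sqr_ge0.
rewrite ge0_integralD_EFin//; last 3 first.
- exact: m3.
- exact: p3.
- by move=> z Oz; rewrite mulr_ge0 ?sqr_ge0.
rewrite (@ge0_integralZl_real _ _ _ (@leb2 R) Om' mO' (fun z => mollify r 0 0 z ^+ 2))//;
  [|exact: measurable_funX|by move=> z _; exact: sqr_ge0].
rewrite (@ge0_integralZl_real _ _ _ (@leb2 R) Om' mO' (fun z => r z ^+ 2))//;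
  [|exact: measurable_funX|by move=> z _; exact: sqr_ge0].
rewrite integral_cst// addeA; apply: leeD.
  have -> : (6 * A)%:E = (3%:E * A%:E + 3%:E * A%:E)%E.
    by rewrite -!EFinM -EFinD; congr EFin; ring.
  by apply: leeD; apply: lee_wpmul2l.
apply: lee_wpmul2l; first by rewrite lee_fin mulr_ge0 ?sqr_ge0.
by apply: le_measure => //; rewrite inE.
Qed.

End Mollification.

Section MollificationLimit.
Variable R : realType.
Local Notation mR := (measurableTypeR R).
Variables (a b c d : R).
Let Om : set (mR * mR) := orect a b c d.

(** The threshold is uniform over all mollifiers of a given radius, whatever their constant [C],
    since the mollifier is chosen only after [del]. *)
Lemma mollify_cvg_L2 (u : R * R -> R) :
  measurable_fun (Om : set (mR * mR)) u ->
  (\int[@leb2 R]_(z in Om) (u z ^+ 2)%:E < +oo)%E ->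
  forall e : R, 0 < e -> exists2 del0 : R, 0 < del0 &
    forall del rho C, 0 < del -> del <= del0 -> gevrey_mollifier del rho C ->
    (\int[@leb2 R]_(z in orect (a + del) (b - del) (c + del) (d - del))
       ((mollify rho a b c d u 0 0 z - u z) ^+ 2)%:E < e%:E)%E.
Proof.
move=> mu_ u2 e e0; have e24 : 0 < e / 24 by rewrite divr_gt0.
have [g Lg ug] := L2_density_orect mu_ u2 e24.
have [mg [K gK gL]] := Lg.
have K0 : 0 <= K by exact: le_trans (normr_ge0 _) (gK (0, 0)).
have fO : @leb2 R Om = (fine (@leb2 R Om))%:E.
  by rewrite fineK// ge0_fin_numE//; exact: leb2_orect_lty.
set m := fine _ in fO.
have m0 : 0 <= m by rewrite fine_ge0.
(* The approximation [g] costs [6 * (e / 24) = e / 4]. The Lipschitz term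
   [12 * del ^+ 2 * K ^+ 2 * m] is at most [del * S / 2 <= e / 2], where [del <= 1] drops one power
   of [del]; the added 1's keep [S] positive. *)
pose S := 12 * (K + 1) ^+ 2 * (m + 1) * 2.
have K1 : 0 < K + 1 by lra.
have m1 : 0 < m + 1 by lra.
have S0 : 0 < S.
  have -> : S = 24 * ((K + 1) ^+ 2 * (m + 1)) by rewrite /S; ring.
  by rewrite mulr_gt0// mulr_gt0// exprn_gt0.
exists (Num.min 1 (e / S)).
  by rewrite lt_min ltr01 divr_gt0.
move=> del rho C del0; rewrite le_min => /andP[del1 delS] moll.
apply: (le_lt_trans (mollify_error_le del0 moll mu_ u2 Lg gL K0 (ltW ug))).
rewrite -/Om fO -EFinM -EFinD lte_fin.
have : del * S <= e by rewrite -ler_pdivlMr.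
have : 3 * (K * (2 * del)) ^+ 2 * m <= del * S / 2; last by lra.
have -> : 3 * (K * (2 * del)) ^+ 2 * m = 12 * del * (del * K ^+ 2 * m) by ring.
have -> : del * S / 2 = 12 * del * ((K + 1) ^+ 2 * (m + 1)) by rewrite /S; field.
rewrite ler_pM2l ?mulr_gt0//; apply: ler_pM => //.
- by rewrite mulr_ge0 ?sqr_ge0// ltW.
- rewrite -[leRHS]mul1r ler_pM ?sqr_ge0// ?(ltW del0)//.
  by rewrite ler_sqr ?nnegrE; lra.
- lra.
Qed.

End MollificationLimit.

(** * The mollified solution and its Gevrey bounds *)

(** Replacing five [x]-derivatives by one [t]-derivative is affordable: the latter adds 2 to the
    argument of the factorial, while [uphalf] of [j + 5] exceeds [uphalf j] by at least 2. *)
Lemma uphalf_leq5 (k j : nat) :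
  [/\ 2 * k.+1 + uphalf j <= 2 * k + uphalf j.+4.+1,
      2 * k + uphalf j.+1 <= 2 * k + uphalf j.+4.+1 &
      2 * k + uphalf j.+3 <= 2 * k + uphalf j.+4.+1]%N.
Proof. by split; lia. Qed.

Lemma four_two_succ (R : realType) (k j : nat) :
  4 ^+ k.+1 * 2 ^+ j = 4 ^+ k * 2 ^+ j * 4 :> R.
Proof. by rewrite exprS; ring. Qed.

Lemma four_two_exp1 (R : realType) (k j : nat) :
  4 ^+ k * 2 ^+ j.+1 = 4 ^+ k * 2 ^+ j * 2 :> R.
Proof. by rewrite exprS; ring. Qed.

Lemma four_two_exp3 (R : realType) (k j : nat) :
  4 ^+ k * 2 ^+ j.+3 = 4 ^+ k * 2 ^+ j * 8 :> R.
Proof. by rewrite 3!exprS; ring. Qed.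

Lemma four_two_exp5 (R : realType) (k j : nat) :
  4 ^+ k * 2 ^+ j.+4.+1 = 4 ^+ k * 2 ^+ j * 32 :> R.
Proof. by rewrite 5!exprS; ring. Qed.

Section KernelTest.
Variable R : realType.
Local Notation mR := (measurableTypeR R).
Variables (del : R) (rho : nat -> R -> R) (C : R).
Hypothesis del0 : 0 < del.
Hypothesis moll : gevrey_mollifier del rho C.
Implicit Types (k m : nat) (z w : R * R) (x y s t e h : R).

(** The mean value theorem is applied to [f (x + s) - s * f' x], whose derivative is at most
    [K * |h|] between 0 and [h]. *)
Lemma is_derive_taylor2 (f f' : R -> R) (K : R) :
  (forall x, is_derive x 1 f (f' x)) ->
  (forall x y, `|f' x - f' y| <= K * `|x - y|) ->
  forall x h, `|f (x + h) - f x - h * f' x| <= K * h ^+ 2.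
Proof.
move=> df f'K x h.
have K0 : 0 <= K.
  by have := le_trans (normr_ge0 _) (f'K 1 0); rewrite subr0 normr1 mulr1.
have dg y : is_derive y 1 (fun s => f (x + s) - s * f' x) (f' (x + y) - f' x).
  have d1 : is_derive y 1 (fun s => x + s) 1.
    by have := is_deriveD (is_derive_cst x y 1) (is_derive_id y 1); rewrite add0r.
  have d2 := @is_derive1_comp R _ _ y _ _ (df (x + y)) d1.
  have d3 : is_derive y 1 (fun s => s * f' x) (f' x).
    have := @is_deriveM R R id (cst (f' x)) y 1 _ _ (is_derive_id y 1) (is_derive_cst _ _ _).
    by rewrite scaler0 add0r /GRing.scale/= mulr1.
  by have := is_deriveB d2 d3; rewrite mulr1.
have cg := continuous_is_derive dg.
have -> : f (x + h) - f x - h * f' x =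
    f (x + h) - h * f' x - (f (x + 0) - 0 * f' x).
  by rewrite addr0 mul0r; ring.
have bound y : `|y| <= `|h| -> `|f' (x + y) - f' x| <= K * `|h|.
  move=> yh; apply: (le_trans (f'K _ _)); rewrite ler_wpM2l//.
  by have -> : x + y - x = y by ring.
have [h0|h0] := leP 0 h.
  have [c + ->] := MVT_segment h0 (fun y _ => dg y) (continuous_subspaceT cg).
  rewrite in_itv/= => /andP[c0 ch].
  rewrite subr0 normrM -real_normK ?num_real// expr2 mulrA ler_wpM2r//.
  by apply: bound; rewrite !ger0_norm.
have [c + E] := MVT_segment (ltW h0) (fun y _ => dg y) (continuous_subspaceT cg).
rewrite in_itv/= => /andP[hc c0].
rewrite distrC E sub0r normrM normrN -(real_normK (num_real h)) expr2 mulrA ler_wpM2r//.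
by apply: bound; rewrite !ler0_norm ?lerN2// ltW.
Qed.

Lemma rho_taylor2 k x h :
  `|rho k (x + h) - rho k x - h * rho k.+1 x| <= mbound C k.+2 * h ^+ 2.
Proof.
apply: is_derive_taylor2; first exact: moll_derive moll k.
exact: rho_lipschitz moll k.+1.
Qed.

Lemma is_derive_rho_subl k t s :
  is_derive s 1 (fun s => rho k (t - s)) (- rho k.+1 (t - s)).
Proof.
have := @is_derive1_comp R _ _ s _ _ (moll_derive moll k (t - s)) (is_derive_subl t s).
by rewrite mulrN1.
Qed.

Lemma is_derive_scale (f : R -> R) e x l :
  is_derive x 1 f l -> is_derive x 1 (fun y => e * f y) (e * l).
Proof. by move=> df; have := @is_deriveZ R R R f e x 1 l df. Qed.

Lemma is_derive_scaler (f : R -> R) e x l :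
  is_derive x 1 f l -> is_derive x 1 (fun y => f y * e) (l * e).
Proof.
move=> df; rewrite mulrC; under eq_fun do rewrite mulrC.
exact: is_derive_scale.
Qed.

Lemma is_derive_ker_t k m z s y :
  is_derive s 1 (fun s => ker rho k m z (s, y)) (- ker rho k.+1 m z (s, y)).
Proof.
rewrite /ker/= -mulNr; apply: is_derive_scaler; exact: is_derive_rho_subl.
Qed.

Lemma is_derive_ker_x k m z s y :
  is_derive y 1 (fun y => ker rho k m z (s, y)) (- ker rho k m.+1 z (s, y)).
Proof.
rewrite /ker/= -mulrN; apply: is_derive_scale; exact: is_derive_rho_subl.
Qed.

(** Each derivative in [w] flips the sign; the scalar [e] records it so that the rule can be
    iterated. *)
Lemma dt_ker k m z e :
  dt (fun w => e * ker rho k m z w) = (fun w => - e * ker rho k.+1 m z w).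
Proof.
apply/funext => -[s y]; rewrite /dt /= derive1E mulNr -mulrN.
by have := is_derive_scale e (is_derive_ker_t k m z s y) => /@derive_val.
Qed.

Lemma dx_ker k m z e :
  dx (fun w => e * ker rho k m z w) = (fun w => - e * ker rho k m.+1 z w).
Proof.
apply/funext => -[s y]; rewrite /dx /= derive1E mulNr -mulrN.
by have := is_derive_scale e (is_derive_ker_x k m z s y) => /@derive_val.
Qed.

Lemma pder_ker l k m z : exists e k' m',
  pder l (ker rho k m z) = (fun w => e * ker rho k' m' z w).
Proof.
elim: l => [|b l [e [k' [m' IH]]]] /=.
  by exists 1, k, m; apply/funext => w; rewrite mul1r.
rewrite IH; case: b; first by exists (- e), k'.+1, m'; rewrite dt_ker.
by exists (- e), k', m'.+1; rewrite dx_ker.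
Qed.

(** All derivatives in [P] have odd order, so the sign flips of [z - w] cancel the signs of the
    adjoint: the adjoint in [w] acts on the kernel as [P] in [z]. *)
Lemma Padj_ker k m z w : Padj (ker rho k m z) w =
  ker rho k.+1 m z w + ker rho k m.+1 z w + ker rho k m.+3 z w - ker rho k m.+4.+1 z w.
Proof.
have -> : ker rho k m z = (fun w => 1 * ker rho k m z w).
  by apply/funext => v; rewrite mul1r.
by rewrite /Padj dt_ker !dx_ker; ring.
Qed.

Lemma continuous_ker k m z e : continuous (fun w => e * ker rho k m z w).
Proof.
set K := mbound C k.+1 * mbound C m + mbound C k * mbound C m.+1.
apply: (@dist2_lipschitz_continuous _ _ (`|e| * K)) => w w'.
have kE v : ker rho k m z v = ker rho k m (z.1 - v.1, z.2 - v.2) (0, 0).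
  by rewrite /ker/= !subr0.
rewrite -mulrBr normrM -mulrA ler_wpM2l// !kE.
apply: (le_trans (ker_lipschitz moll _ _ _ _ _)); rewrite -/K.
have -> // : dist2 (z.1 - w.1, z.2 - w.2) (z.1 - w'.1, z.2 - w'.2) = dist2 w w'.
rewrite /dist2/=.
have -> : z.1 - w.1 - (z.1 - w'.1) = w'.1 - w.1 by ring.
have -> : z.2 - w.2 - (z.2 - w'.2) = w'.2 - w.2 by ring.
by rewrite distrC (distrC w'.2).
Qed.

Lemma smooth2_ker k m z : smooth2 (ker rho k m z).
Proof.
move=> l; have [e [k' [m' ->]]] := pder_ker l k m z; split.
  exact: continuous_ker.
move=> w; split.
  by have [] := is_derive_scale e (is_derive_ker_t k' m' z w.1 w.2).
by have [] := is_derive_scale e (is_derive_ker_x k' m' z w.1 w.2).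
Qed.

Variables (a b c d : R).
Let Om : set (mR * mR) := orect a b c d.
Let Om' : set (mR * mR) := orect (a + del) (b - del) (c + del) (d - del).

Lemma test_fun_ker k m z : Om' z -> test_fun Om (ker rho k m z).
Proof.
move=> [/= /andP[z1 z2] /andP[z3 z4]].
pose Q := `[z.1 - del, z.1 + del]%classic `*` `[z.2 - del, z.2 + del]%classic.
have cQ : compact Q by apply: compact_setX; exact: segment_compact.
have clQ : closed Q by apply: compact_closed.
have sQ : fsupp (ker rho k m z) `<=` Q.
  rewrite (closure_id Q).1//; apply: closureS => w /= kw.
  have h1 : `|z.1 - w.1| < del.
    rewrite ltNge; apply: contra kw => h.
    by rewrite /ker (moll_out moll) ?mul0r.
  have h2 : `|z.2 - w.2| < del.
    rewrite ltNge; apply: contra kw => h.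
    by rewrite /ker [X in _ * X](moll_out moll) ?mulr0.
  move: h1 h2; rewrite !ltr_norml => /andP[? ?] /andP[? ?].
  by split; rewrite /= in_itv/=; apply/andP; split; lra.
split; first exact: smooth2_ker.
split.
  by apply: subclosed_compact cQ sQ; exact: closed_closure.
move=> w /sQ[/=]; rewrite !in_itv/= => /andP[? ?] /andP[? ?].
by split; apply/andP; split; lra.
Qed.

Variable u : R * R -> R.
Hypothesis iu : (@leb2 R).-integrable Om (EFin \o u).
Local Notation W := (mollify rho a b c d u).

Let mO : measurable Om. Proof. exact: measurable_orect. Qed.

Lemma mollify_norm_le k m z :
  `|W k m z| <= mbound C k * mbound C m * \int[@leb2 R]_(w in Om) `|u w|.
Proof.
apply: norm_pairing_le => //; first exact: (measurable_ker moll).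
by move=> w _; exact: (ker_le moll).
Qed.

Lemma mollify_linear3 k1 m1 k2 m2 z1 z2 e (z : R * R) k3 m3 :
  W k1 m1 z1 - W k2 m2 z2 - e * W k3 m3 z =
  pairing (@leb2 R) Om u (fun w => ker rho k1 m1 z1 w - ker rho k2 m2 z2 w -
    e * ker rho k3 m3 z w).
Proof.
have mk k m v : measurable_fun Om (ker rho k m v) by exact: (measurable_ker moll).
have kB k m v w : Om w -> `|ker rho k m v w| <= mbound C k * mbound C m.
  by move=> _; exact: (ker_le moll).
have ik k m v : (@leb2 R).-integrable Om (EFin \o (fun w => u w * ker rho k m v w)).
  by have := integrable_pairing mO iu (mk k m v) (kB k m v).
have iB : (@leb2 R).-integrable Om (EFin \o (fun w => u w * ker rho k1 m1 z1 w -
    u w * ker rho k2 m2 z2 w)).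
  rewrite /comp; under eq_fun do rewrite EFinB.
  by apply: integrableB => //; exact: ik.
have iZ : (@leb2 R).-integrable Om (EFin \o (fun w => e * (u w * ker rho k3 m3 z w))).
  by rewrite /comp; under eq_fun do rewrite EFinM; apply: integrableZl => //; exact: (ik k3 m3 z).
have i1 := ik k1 m1 z1; have i2 := ik k2 m2 z2; have i3 := ik k3 m3 z.
rewrite /mollify /pairing -RintegralZl// -RintegralB// -RintegralB//.
by apply: eq_Rintegral => w _; ring.
Qed.

(** The quadratic Taylor remainder of the kernel, uniform in [w], is integrated against [|u|]. This
    is valid at every point of the plane, as the integral always runs over [Om]. *)
Lemma is_derive_mollify_t k m t x :
  is_derive t 1 (fun t => W k m (t, x)) (W k.+1 m (t, x)).
Proof.
apply: (@is_derive_quadratic _ _ _ _ (mbound C k.+2 * mbound C m *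
   \int[@leb2 R]_(w in Om) `|u w|)) => h.
rewrite mollify_linear3 mulrAC; apply: norm_pairing_le => //.
  by apply: measurable_funB; [apply: measurable_funB|apply: measurable_funM];
    try exact: (measurable_ker moll); exact: measurable_cst.
move=> w _; rewrite /ker/=.
have -> : t + h - w.1 = t - w.1 + h by ring.
have -> : rho k (t - w.1 + h) * rho m (x - w.2) - rho k (t - w.1) * rho m (x - w.2) -
   h * (rho k.+1 (t - w.1) * rho m (x - w.2)) =
   (rho k (t - w.1 + h) - rho k (t - w.1) - h * rho k.+1 (t - w.1)) * rho m (x - w.2).
  by ring.
rewrite normrM mulrAC ler_pM//; first exact: rho_taylor2.
exact: (rho_le moll).
Qed.

Lemma is_derive_mollify_x k m t x :
  is_derive x 1 (fun x => W k m (t, x)) (W k m.+1 (t, x)).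
Proof.
apply: (@is_derive_quadratic _ _ _ _ (mbound C k * mbound C m.+2 *
   \int[@leb2 R]_(w in Om) `|u w|)) => h.
rewrite mollify_linear3 mulrAC; apply: norm_pairing_le => //.
  by apply: measurable_funB; [apply: measurable_funB|apply: measurable_funM];
    try exact: (measurable_ker moll); exact: measurable_cst.
move=> w _; rewrite /ker/=.
have -> : x + h - w.2 = x - w.2 + h by ring.
have -> : rho k (t - w.1) * rho m (x - w.2 + h) - rho k (t - w.1) * rho m (x - w.2) -
   h * (rho k (t - w.1) * rho m.+1 (x - w.2)) =
   rho k (t - w.1) * (rho m (x - w.2 + h) - rho m (x - w.2) - h * rho m.+1 (x - w.2)).
  by ring.
rewrite normrM -mulrA ler_pM//; last exact: rho_taylor2.
exact: (rho_le moll).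
Qed.

Lemma mollify_eq_interior k m z : Pzero Om u -> Om' z ->
  W k m.+4.+1 z = W k.+1 m z + W k m.+1 z + W k m.+3 z.
Proof.
move=> Pu Oz; have := Pu _ (test_fun_ker k m Oz).
under eq_integral do rewrite Padj_ker.
have mk k' m' v : measurable_fun Om (ker rho k' m' v) by exact: (measurable_ker moll).
have kB k' m' v w : Om w -> `|ker rho k' m' v w| <= mbound C k' * mbound C m'.
  by move=> _; exact: (ker_le moll).
have ik k' m' v : (@leb2 R).-integrable Om
    (EFin \o (fun w => u w * ker rho k' m' v w)).
  by have := integrable_pairing mO iu (mk k' m' v) (kB k' m' v).
move=> H.
have : \int[@leb2 R]_(w in Om) (u w * (ker rho k.+1 m z w + ker rho k m.+1 z w +
   ker rho k m.+3 z w - ker rho k m.+4.+1 z w)) = 0 by rewrite /Rintegral H.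
have -> : \int[@leb2 R]_(w in Om) (u w * (ker rho k.+1 m z w + ker rho k m.+1 z w +
   ker rho k m.+3 z w - ker rho k m.+4.+1 z w)) = W k.+1 m z + W k m.+1 z + W k m.+3 z
     - W k m.+4.+1 z; last by lra.
have i1 := ik k.+1 m z; have i2 := ik k m.+1 z; have i3 := ik k m.+3 z.
have i4 := ik k m.+4.+1 z.
have iD : (@leb2 R).-integrable Om (EFin \o (fun w => u w * ker rho k.+1 m z w +
    u w * ker rho k m.+1 z w)).
  rewrite /comp; under eq_fun do rewrite EFinD.
  by apply: integrableD.
have iD2 : (@leb2 R).-integrable Om (EFin \o (fun w => u w * ker rho k.+1 m z w +
    u w * ker rho k m.+1 z w + u w * ker rho k m.+3 z w)).
  rewrite /comp; under eq_fun do rewrite EFinD.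
  by apply: integrableD.
rewrite /mollify /pairing -RintegralD// -RintegralD// -RintegralB//.
by apply: eq_Rintegral => w _; ring.
Qed.

Variables t1 t2 : R.
Hypothesis usupp : supp_in Om [set z | t1 <= z.1 <= t2 /\ c < z.2 < d] u.

(** The kernel is zero unless the times of [z] and [w] differ by less than [del], and [u] vanishes
    almost everywhere off [[t1, t2]]; the position of [z] in space is free. *)
Lemma mollify_out k m z : (z.1 <= t1 - del) || (t2 + del <= z.1) -> W k m z = 0.
Proof.
move=> zt; rewrite /mollify /pairing /Rintegral.
rewrite (_ : (\int[@leb2 R]_(w in Om) (u w * ker rho k m z w)%:E)%E = 0%E)//.
rewrite -[RHS](@integral0 _ _ _ (@leb2 R) Om).
have mk : measurable_fun Om (ker rho k m z) by exact: (measurable_ker moll).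
have kB w : Om w -> `|ker rho k m z w| <= mbound C k * mbound C m.
  by move=> _; exact: (ker_le moll).
have ik := integrable_pairing mO iu mk kB.
apply: ae_eq_integral => //.
  by have /integrableP[] := ik.
have aeF : Filter (almost_everywhere (@leb2 R)).
  exact: (@ae_filter_ringOfSetsType _ _ _ (@leb2 R)).
move: usupp; apply: filterS => w /= uw Ow.
have [h|h] := pselect (t1 <= w.1 <= t2); last by rewrite uw ?mul0r// => -[].
move: h => /andP[h1 h2].
rewrite /ker (moll_out moll) ?mul0r ?mulr0//.
have d0 := del0; have [zt'|zt'] := orP zt.
  by rewrite ler0_norm; lra.
by rewrite ger0_norm; lra.
Qed.

Hypothesis Pu : Pzero Om u.
Hypothesis t1a : a + 2 * del < t1.
Hypothesis t2b : t2 + 2 * del < b.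

(** Two cases cover all times. Away from [[t1, t2]] every term is 0; within [del] of it, the margins
    of [2 * del] put [z] in [Om'], where the kernel is an admissible test function. *)
Lemma mollify_eq k m z : c + del < z.2 < d - del ->
  W k m.+4.+1 z = W k.+1 m z + W k m.+1 z + W k m.+3 z.
Proof.
move=> z2; have [out|] := boolP ((z.1 <= t1 - del) || (t2 + del <= z.1)).
  by rewrite !mollify_out// !addr0.
rewrite negb_or -!ltNge => /andP[z11 z12].
apply: mollify_eq_interior => //; split => //=.
have := t1a; have := t2b; have := del0 => *; apply/andP; split; lra.
Qed.

(** The sum dominates [mbound C i] for each [i < 5], the orders in [x] that the equation cannot
    reduce; the leading [C] comes from [mbound C k] in time. *)
Definition mollify_cst : R :=
  C * (\sum_(i < 5) mbound C i) * \int[@leb2 R]_(w in Om) `|u w|.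

(* Gevrey order 2 in time costs 2/5 of a factorial per [x]-derivative; [uphalf]
   rounds this up to 1/2, which the factorials of the Taylor series still beat. *)
Lemma mollify_gevrey_le k m z : c + del < z.2 < d - del ->
  `|W k m z| <= mollify_cst * (4 ^+ k * 2 ^+ m * (2 * k + uphalf m)`!%:R).
Proof.
move=> z2.
have U0 : 0 <= \int[@leb2 R]_(w in Om) `|u w| by apply: Rintegral_ge0.
have mb0 := mbound_ge0 moll.
have c0 : 0 <= C by have := mb0 0%N; rewrite /mbound expr0 muln0 fact0 !mulr1.
have cst0 : 0 <= mollify_cst by rewrite /mollify_cst !mulr_ge0// sumr_ge0.
have base i : (i < 5)%N -> forall k,
    `|W k i z| <= mollify_cst * (4 ^+ k * 2 ^+ i * (2 * k + uphalf i)`!%:R).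
  move=> i5 {}k; apply: (le_trans (mollify_norm_le k i z)).
  apply: (@le_trans _ _ (mollify_cst * (4 ^+ k * (2 * k)`!%:R))).
    rewrite /mollify_cst {1}/mbound.
    set S := \sum_(j < 5) _.
    have iS : mbound C i <= S.
      rewrite /S (bigD1 (Ordinal i5))//= lerDl sumr_ge0//.
    have -> : C * S * \int[@leb2 R]_(w in Om) `|u w| * (4 ^+ k * (2 * k)`!%:R) =
      C * (4 ^+ k * (2 * k)`!%:R) * S * \int[@leb2 R]_(w in Om) `|u w| by ring.
    rewrite ler_wpM2r// ler_wpM2l// mulr_ge0// mulr_ge0// exprn_ge0//.
  rewrite ler_wpM2l// -mulrA ler_wpM2l ?exprn_ge0//.
  rewrite -[leLHS]mul1r ler_pM//.
    by rewrite exprn_ege1// ler1n.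
  by rewrite ler_nat; apply: leq_fact; exact: leq_addr.
(* Strong induction on [m] for all [k] together: the equation lowers the order in [x] but may raise
   the order in time. *)
elim/ltn_ind: m k => m IH k.
have [|m5] := ltnP m 5; first by move=> /base.
have [j mE] : exists j, m = j.+4.+1.
  by exists (m - 5)%N; rewrite -[in LHS](subnKC m5).
rewrite {}mE in IH *; rewrite {m5}mollify_eq//.
set F : R := (2 * k + uphalf j.+4.+1)`!%:R.
have leF p : (p <= 2 * k + uphalf j.+4.+1)%N -> p`!%:R <= F.
  by move=> pF; rewrite ler_nat; exact: leq_fact.
have G0 : 0 <= 4 ^+ k * 2 ^+ j :> R by rewrite mulr_ge0 ?exprn_ge0.
have step k' m' (e : R) : (m' < j.+4.+1)%N ->
    (2 * k' + uphalf m' <= 2 * k + uphalf j.+4.+1)%N ->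
    4 ^+ k' * 2 ^+ m' = 4 ^+ k * 2 ^+ j * e -> 0 <= e ->
    `|W k' m' z| <= mollify_cst * (4 ^+ k * 2 ^+ j * (e * F)).
  move=> mj kj E e0; apply: (le_trans (IH m' mj k')).
  rewrite ler_wpM2l// E -mulrA ler_wpM2l// ler_wpM2l//; exact: leF.
have [j1 j2 j3] := uphalf_leq5 k j.
have b1 := step k.+1 j 4 (leq_addl 4 j.+1) j1 (four_two_succ R k j) (ler0n _ 4).
have b2 := step k j.+1 2 (leq_addl 3 j.+2) j2 (four_two_exp1 R k j) (ler0n _ 2).
have b3 := step k j.+3 8 (leq_addl 1 j.+4) j3 (four_two_exp3 R k j) (ler0n _ 8).
have F0 : 0 <= F by [].
apply: (le_trans (ler_normD _ _)).
apply: (le_trans (lerD (ler_normD _ _) (lexx _))).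
apply: (le_trans (lerD (lerD b1 b2) b3)).
rewrite -!mulrDr ler_wpM2l//.
(* The three terms weigh [4 + 2 + 8 = 14], below the [32 = 2 ^+ 5] granted by five
   [x]-derivatives. *)
rewrite four_two_exp5 -[leRHS]mulrA ler_wpM2l//; lra.
Qed.

End KernelTest.

(** * Taylor expansion *)

Section Taylor.
Variable R : realType.
Implicit Types (x y s t e h : R) (f : nat -> R -> R).

Lemma is_derive_expn_fact j x :
  is_derive x 1 (fun y : R => y ^+ j.+1 / j.+1`!%:R) (x ^+ j / j`!%:R).
Proof.
have dX : is_derive x 1 (fun y : R => y ^+ j.+1) (j.+1%:R * x ^+ j).
  have := @is_deriveX R R id j.+1 x 1 1 (is_derive_id x 1).
  by rewrite exprfctE /GRing.scale/= mulr1.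
apply: (is_derive_eq (is_derive_scaler j.+1`!%:R^-1 dX)).
have f0 : j`!%:R != 0 :> R by rewrite pnatr_eq0 -lt0n fact_gt0.
have n0 : j.+1%:R != 0 :> R by rewrite pnatr_eq0.
rewrite factS natrM; move: (j.+1%:R : R) (j`!%:R : R) n0 f0 => n F n0 F0.
by field; rewrite F0 n0.
Qed.

Definition taylor f (N : nat) x := \sum_(j < N) f j 0 * (x ^+ j / j`!%:R).

Lemma is_derive_taylor f N x :
  is_derive x 1 (taylor f N.+1) (taylor (fun j => f j.+1) N x).
Proof.
have -> : taylor f N.+1 = cst (f 0%N 0) +
    \sum_(j < N) (fun y => f j.+1 0 * (y ^+ j.+1 / j.+1`!%:R)).
  apply/funext => y; rewrite /taylor big_ord_recl expr0 fact0 divr1 mulr1.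
  by rewrite !fctE; congr (_ + _); rewrite fct_sumE.
rewrite -[X in is_derive _ _ _ X]add0r; apply: is_deriveD; apply: is_derive_sum => j.
exact: is_derive_scale (is_derive_expn_fact j x).
Qed.

Lemma taylor0 f N : taylor f N.+1 0 = f 0%N 0.
Proof.
rewrite /taylor big_ord_recl expr0 fact0 divr1 mulr1 big1 ?addr0// => j _.
by rewrite exprS mul0r mul0r mulr0.
Qed.

Lemma le_is_derive_ge0 (g g' : R -> R) x : 0 <= x ->
  (forall y, is_derive y 1 g (g' y)) -> (forall y, 0 <= y <= x -> 0 <= g' y) ->
  g 0 <= g x.
Proof.
move=> x0 dg g'0.
have [c + E] := MVT_segment x0 (fun y _ => dg y)
  (continuous_subspaceT (continuous_is_derive dg)).
rewrite in_itv/= => /g'0 gc; rewrite -subr_ge0 E subr0 mulr_ge0//.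
Qed.

(** Induction on [N] along the derivative sequence: the estimate for [f 1] says that
    [B * x ^+ N.+1 / N.+1!] plus or minus the remainder is nondecreasing on [[0, X]], and it
    vanishes at 0. *)
Lemma taylor_remainder_ge0 f (N : nat) (B X : R) :
  (forall j x, is_derive x 1 (f j) (f j.+1 x)) ->
  (forall x, 0 <= x <= X -> `|f N x| <= B) ->
  forall x, 0 <= x <= X -> `|f 0%N x - taylor f N x| <= B * (x ^+ N / N`!%:R).
Proof.
elim: N f => [|N IH] f df fB x xX.
  by rewrite /taylor big_ord0 subr0 expr0 fact0 divr1 mulr1; exact: fB.
have {}IH := IH (fun j => f j.+1) (fun j => df j.+1) fB.
have /andP[x0 xX'] := xX.
have dp y := is_derive_scale B (is_derive_expn_fact N y).
have dg y : is_derive y 1 (f 0%N - taylor f N.+1)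
    (f 1%N y - taylor (fun j => f j.+1) N y).
  by apply: is_deriveB; exact: is_derive_taylor.
have IH' y : 0 <= y <= x -> `|f 1%N y - taylor (fun j => f j.+1) N y| <=
    B * (y ^+ N / N`!%:R).
  by move=> /andP[y0 yx]; apply: IH; rewrite y0 (le_trans yx).
have p0 : B * (0 ^+ N.+1 / N.+1`!%:R) = 0 by rewrite exprS mul0r mul0r mulr0.
rewrite ler_norml; apply/andP; split.
  have := @le_is_derive_ge0 _ _ x x0 (fun y => is_deriveD (dg y) (dp y)).
  rewrite !fctE p0 taylor0 subrr addr0 => H.
  rewrite -subr_ge0 opprK; apply: H => y /IH'.
  by rewrite ler_norml => /andP[h _]; lra.
have := @le_is_derive_ge0 _ _ x x0 (fun y => is_deriveB (dp y) (dg y)).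
rewrite !fctE p0 taylor0 subrr subr0 => H.
rewrite -subr_ge0; apply: H => y /IH'.
by rewrite ler_norml => /andP[_ h]; lra.
Qed.

Lemma taylor_remainder f (N : nat) (B X : R) :
  (forall j x, is_derive x 1 (f j) (f j.+1 x)) ->
  (forall x, `|x| <= X -> `|f N x| <= B) ->
  forall x, `|x| <= X -> `|f 0%N x - taylor f N x| <= B * (`|x| ^+ N / N`!%:R).
Proof.
move=> df fB x xX; have [x0|x0] := leP 0 x.
  rewrite (ger0_norm x0); apply: (@taylor_remainder_ge0 f N B X) => //.
    by move=> y /andP[y0 yX]; apply: fB; rewrite ger0_norm.
  by rewrite x0/= -(ger0_norm x0).
(* Negative [x] reduces to the previous case by reflection: these are the successive derivatives of
   [f 0 (- y)]. *)
have dneg j y : is_derive y 1 (fun y => (-1) ^+ j * f j (- y))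
    ((-1) ^+ j.+1 * f j.+1 (- y)).
  have dN := @is_derive1_comp R _ _ y _ _ (df j (- y)) (is_deriveNid y 1).
  apply: (is_derive_eq (is_derive_scale ((-1) ^+ j) dN)).
  by rewrite exprS; ring.
have := @taylor_remainder_ge0 (fun j y => (-1) ^+ j * f j (- y)) N B X dneg _ (- x).
rewrite expr0 mul1r opprK (ltr0_norm x0) => H.
have -> : taylor f N x = taylor (fun j y => (-1) ^+ j * f j (- y)) N (- x).
  apply: eq_bigr => j _; rewrite oppr0 (exprNn x).
  have : (-1) ^+ j * (-1) ^+ j = 1 :> R by rewrite -exprMn mulrNN mulr1 expr1n.
  move: ((-1) ^+ j : R) (x ^+ j) (f j 0) (j`!%:R^-1 : R) => e y F i ee.
  transitivity (e * e * (F * (y * i))); [by rewrite ee mul1r|ring].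
apply: H.
  move=> y /andP[y0 yX]; rewrite normrM normrX normrN1 expr1n mul1r.
  by apply: fB; rewrite normrN ger0_norm.
by rewrite -(ltr0_norm x0) normr_ge0.
Qed.

End Taylor.

(** * Boundedness of the coefficients of the Taylor series *)

Section SuperExponential.
Variable R : realType.

Definition coefseq (A : R) (p j : nat) : R := A ^+ j * (p + uphalf j)`!%:R / j`!%:R.

Lemma coefseq_ge0 A p j : 0 <= A -> 0 <= coefseq A p j.
Proof. by move=> A0; rewrite /coefseq divr_ge0// mulr_ge0// exprn_ge0. Qed.

(** Steps of 2 raise [uphalf j] by exactly 1: the quotient gains one factor above and two below. The
    bound [p + uphalf j + 1 <= p.+1 * j.+1] then cancels [j.+1]. *)
Lemma coefseq_step A p j : 0 <= A -> A ^+ 2 * p.+1%:R <= j%:R ->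
  coefseq A p j.+2 <= coefseq A p j.
Proof.
move=> A0 Aj; rewrite /coefseq.
have -> : (p + uphalf j.+2 = (p + uphalf j).+1)%N by lia.
rewrite !factS !natrM.
set q : R := (p + uphalf j)`!%:R; set r : R := j`!%:R.
have r0 : 0 < r by rewrite ltr0n fact_gt0.
have q0 : 0 <= q by [].
set a : R := (p + uphalf j).+1%:R.
have j1 : 0 < j.+1%:R :> R by [].
have j2 : 0 < j.+2%:R :> R by [].
have -> : A ^+ j.+2 * (a * q) / (j.+2%:R * (j.+1%:R * r)) =
   A ^+ j * q / r * ((A ^+ 2 * a) / (j.+2%:R * j.+1%:R)).
  by rewrite 2!exprS; field; rewrite !gt_eqF.
rewrite -[leRHS]mulr1 ler_wpM2l//.
  by rewrite divr_ge0 ?(ltW r0)// mulr_ge0// exprn_ge0.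
rewrite ler_pdivrMr ?mulr_gt0// mul1r.
apply: (@le_trans _ _ (A ^+ 2 * (p.+1%:R * j.+1%:R))).
  rewrite ler_wpM2l ?sqr_ge0// /a -natrM ler_nat.
  have : (uphalf j <= j)%N by lia.
  by nia.
rewrite mulrA ler_wpM2r// (le_trans Aj)// ler_nat; lia.
Qed.

Lemma coefseq_bounded A p : 0 <= A -> exists K, forall j, coefseq A p j <= K.
Proof.
move=> A0; pose n := Num.Def.truncn (A ^+ 2 * p.+1%:R).
exists (\sum_(i < n.+3) coefseq A p i) => j.
have S0 i : (i < n.+3)%N -> coefseq A p i <= \sum_(i < n.+3) coefseq A p i.
  move=> ij; rewrite (bigD1 (Ordinal ij))//= lerDl sumr_ge0// => l _.
  exact: coefseq_ge0.
elim/ltn_ind: j => j IH; have [/S0//|jn] := ltnP j n.+3.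
have [i iE] : exists i, j = i.+2 by exists j.-2; lia.
rewrite iE in IH jn *.
apply: le_trans (IH i _); last lia.
apply: coefseq_step => //.
apply: (le_trans (ltW (Num.Theory.truncnS_gt _))); rewrite ler_nat -/n; lia.
Qed.

End SuperExponential.

(** * Integration by parts against a test function *)

(** The pointwise Lagrange identity between [P] and its adjoint, indices standing for orders of
    derivation. Each group on the right is an exact derivative, for instance [F0 * p5 + F5 * p0] is
    that of the alternating sum of [Fi * pj] with [i + j = 4]. *)
Lemma by_parts_identity (R : comPzRingType) (pt p0 p1 p3 p5 F0 F1 F3 F5 Ft : R) :
  F0 * (- pt - p1 - p3 + p5) - (Ft + F1 + F3 - F5) * p0 =
  - (Ft * p0 + F0 * pt) +
  (F0 * p5 + F5 * p0 - (F0 * p3 + F3 * p0) - (F1 * p0 + F0 * p1)).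
Proof. ring. Qed.

Section IntegrationByParts.
Variable R : realType.
Local Notation mR := (measurableTypeR R).
Let mu := @lebesgue_measure R.
Variables (a b c d : R).
Let Om : set (mR * mR) := orect a b c d.
Implicit Types (f g H phi : R * R -> R) (z : R * R) (x y s t e : R).

Let mO : measurable Om. Proof. exact: measurable_orect. Qed.
Let fO : (@leb2 R Om < +oo)%E. Proof. exact: leb2_orect_lty. Qed.

Lemma continuous_bounded_orect f : continuous f ->
  exists K, forall z, Om z -> `|f z| <= K.
Proof.
move=> cf; pose Q : set (R * R) := `[a, b]%classic `*` `[c, d]%classic.
have cQ : compact Q by apply: compact_setX; exact: segment_compact.
have /compact_bounded[M [_ fM]] := continuous_compact (continuous_subspaceT cf) cQ.
exists (M + 1) => z [/= /andP[z1 z2] /andP[z3 z4]].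
apply: (fM (M + 1)); first by rewrite ltrDl.
exists z => //; split; rewrite /= in_itv/=; apply/andP; split; exact: ltW.
Qed.

Lemma continuous_integrable_orect f : continuous f ->
  (@leb2 R).-integrable Om (EFin \o f).
Proof.
move=> cf; have [K fK] := continuous_bounded_orect cf.
apply: (@le_bounded_integrable _ _ _ (@leb2 R) Om mO fO f K) => //.
exact: continuous_measurable2.
Qed.

Lemma nbhs_section_x (P : set (R * R)) t y :
  nbhs ((t, y) : R * R) P -> \forall y' \near y, P (t, y').
Proof.
move=> /nbhs_ballP[r /= r0 rP]; apply/nbhs_ballP; exists r => // y' yy'.
by apply: rP; split => //=; exact: ballxx.
Qed.

Lemma nbhs_section_t (P : set (R * R)) t y :
  nbhs ((t, y) : R * R) P -> \forall t' \near t, P (t', y).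
Proof.
move=> /nbhs_ballP[r /= r0 rP]; apply/nbhs_ballP; exists r => // t' tt'.
by apply: rP; split => //=; exact: ballxx.
Qed.

Lemma continuous_section_x f t : continuous f -> continuous (fun y => f (t, y)).
Proof.
move=> cf y; apply/cvgrPdist_lt => e e0.
by have /cvgrPdist_lt /(_ _ e0) /nbhs_section_x := cf (t, y).
Qed.

Lemma continuous_section_t f y : continuous f -> continuous (fun t => f (t, y)).
Proof.
move=> cf t; apply/cvgrPdist_lt => e e0.
by have /cvgrPdist_lt /(_ _ e0) /nbhs_section_t := cf (t, y).
Qed.

Lemma fubini_orect_tx f : continuous f ->
  (\int[@leb2 R]_(z in Om) (f z)%:E =
   \int[mu]_(x in `]a, b[) \int[mu]_(y in `]c, d[) (f (x, y))%:E)%E.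
Proof.
move=> cf; rewrite integral_mkcond /leb2.
rewrite -(@integral12_prod_meas1 _ _ _ _ _ mu mu) /fubini_F; last first.
  have := continuous_integrable_orect cf.
  by rewrite (integrable_mkcond _ mO).
under eq_integral do rewrite orect_patch.
by rewrite -integral_mkcond.
Qed.

Lemma fubini_orect_xt f : continuous f ->
  (\int[@leb2 R]_(z in Om) (f z)%:E =
   \int[mu]_(y in `]c, d[) \int[mu]_(x in `]a, b[) (f (x, y))%:E)%E.
Proof.
move=> cf; rewrite integral_mkcond /leb2.
rewrite -(@integral21_prod_meas1 _ _ _ _ _ mu mu) /fubini_G; last first.
  have := continuous_integrable_orect cf.
  by rewrite (integrable_mkcond _ mO).
under eq_integral do rewrite orect_patch'.
by rewrite -integral_mkcond.
Qed.

Lemma integral_derive_itv (h h' : R -> R) (p q : R) : p < q -> continuous h' ->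
  (forall x, is_derive x 1 h (h' x)) -> h p = 0 -> h q = 0 ->
  (\int[mu]_(x in `]p, q[) (h' x)%:E = 0)%E.
Proof.
move=> pq ch' dh hp hq.
rewrite -(@integral_itv_bndoo _ _ _ _ true false); last first.
  by apply/measurable_EFinP; apply: measurable_funTS; exact: continuous_measurable_fun.
rewrite (@continuous_FTC2 _ h' h)//.
- by rewrite hp hq subee.
- exact: continuous_subspaceT.
- exact: is_derive_oo_LR dh.
- by move=> x _; rewrite derive1E; have := dh x => /@derive_val.
Qed.

Hypotheses (ab : a < b) (cd : c < d).

Lemma integral_dx_eq0 H (H' : R * R -> R) : continuous H' ->
  (forall t x, is_derive x 1 (fun y => H (t, y)) (H' (t, x))) ->
  (forall t, H (t, c) = 0) -> (forall t, H (t, d) = 0) ->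
  \int[@leb2 R]_(z in Om) H' z = 0.
Proof.
move=> cH dH Hc Hd; rewrite /Rintegral fubini_orect_tx//.
rewrite integral0_eq// => t _.
apply: (@integral_derive_itv (fun y => H (t, y)) (fun y => H' (t, y))) => //.
exact: continuous_section_x.
Qed.

Lemma integral_dt_eq0 H (H' : R * R -> R) : continuous H' ->
  (forall t x, is_derive t 1 (fun s => H (s, x)) (H' (t, x))) ->
  (forall x, H (a, x) = 0) -> (forall x, H (b, x) = 0) ->
  \int[@leb2 R]_(z in Om) H' z = 0.
Proof.
move=> cH dH Hc Hd; rewrite /Rintegral fubini_orect_xt//.
rewrite integral0_eq// => x _.
apply: (@integral_derive_itv (fun t => H (t, x)) (fun t => H' (t, x))) => //.
exact: continuous_section_t.
Qed.

(** Off its closed support [phi] vanishes on a neighbourhood, so every derivative does. As the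
    support lies in the open rectangle, all boundary terms of the integrations by parts are 0. *)
Lemma pder_out phi l z : ~ fsupp phi z -> pder l phi z = 0.
Proof.
elim: l z => [|e l IH] z nz /=.
  apply/eqP; apply: contra_notT nz => pz; exact: subset_closure.
have near0 : \forall w \near z, pder l phi w = 0.
  have : nbhs z (~` fsupp phi).
    apply: open_nbhs_nbhs; split => //; apply: closed_openC; exact: closed_closure.
  by apply: filterS => w; exact: IH.
case: z nz near0 => t y nz near0.
case: e; rewrite /dt /dx derive1E /=.
  have dt0 : is_derive t 1 (fun s => pder l phi (s, y)) 0.
    apply: (@near_eq_is_derive R R R (cst 0)).
    by move/nbhs_section_t : near0; apply: filterS => s ->.
  exact: derive_val.
have dx0 : is_derive y 1 (fun s => pder l phi (t, s)) 0.
  apply: (@near_eq_is_derive R R R (cst 0)).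
  by move/nbhs_section_x : near0; apply: filterS => s ->.
exact: derive_val.
Qed.

Lemma continuousM2 f g : continuous f -> continuous g ->
  continuous (fun z => f z * g z).
Proof. by move=> cf cg z; apply: cvgM; [exact: cf|exact: cg]. Qed.

Lemma continuousD2 f g : continuous f -> continuous g ->
  continuous (fun z => f z + g z).
Proof. by move=> cf cg z; apply: cvgD; [exact: cf|exact: cg]. Qed.

Lemma continuousN2 f : continuous f -> continuous (fun z => - f z).
Proof. by move=> cf z; apply: cvgN; exact: cf. Qed.

Lemma continuousB2 f g : continuous f -> continuous g ->
  continuous (fun z => f z - g z).
Proof. by move=> cf cg; apply: continuousD2 => //; exact: continuousN2. Qed.

Lemma is_derive_prod (f g : R -> R) x l l' : is_derive x 1 f l -> is_derive x 1 g l' ->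
  is_derive x 1 (fun y => f y * g y) (l * g x + f x * l').
Proof.
move=> df dg; apply: (is_derive_eq (is_deriveM df dg)).
by rewrite /GRing.scale/= addrC mulrC.
Qed.

Variable phi : R * R -> R.
Hypothesis tphi : test_fun Om phi.

Let p_ i := pder (nseq i false) phi.

Lemma continuous_pder l : continuous (pder l phi).
Proof. by have [/(_ l)[]] := tphi. Qed.

Lemma continuous_Padj : continuous (Padj phi).
Proof.
apply: continuousD2; last exact (@continuous_pder (nseq 5 false)).
apply: continuousB2; last exact (@continuous_pder (nseq 3 false)).
apply: continuousB2; last exact (@continuous_pder (nseq 1 false)).
by apply: continuousN2; exact (@continuous_pder [:: true]).
Qed.

Lemma is_derive_pder_x i t x :
  is_derive x 1 (fun y => p_ i (t, y)) (p_ i.+1 (t, x)).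
Proof.
have [/(_ (nseq i false)) [_ /(_ (t, x)) [_ dp]] _] := tphi.
by apply: DeriveDef => //; rewrite -derive1E.
Qed.

Lemma is_derive_phi_t t x :
  is_derive t 1 (fun s => phi (s, x)) (dt phi (t, x)).
Proof.
have [/(_ [::]) [_ /(_ (t, x)) [dp _]] _] := tphi.
by apply: DeriveDef => //; rewrite -derive1E.
Qed.

Lemma pder_boundary l z : ~ Om z -> pder l phi z = 0.
Proof. by move=> nz; apply: pder_out => sz; apply: nz; case: tphi => _ [_ /(_ _ sz)]. Qed.

Variables (F : nat -> R * R -> R) (Ft : R * R -> R).
Hypothesis cF : forall i, continuous (F i).
Hypothesis cFt : continuous Ft.
Hypothesis dFt : forall t x, is_derive t 1 (fun s => F 0 (s, x)) (Ft (t, x)).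
Hypothesis dFx : forall i t x, (i < 5)%N ->
  is_derive x 1 (fun y => F i (t, y)) (F i.+1 (t, x)).

(** [F] is a chain of functions rather than the iterated [dx] of one function, so that partial sums
    of decreasing length can be substituted for it. *)
Lemma Padj_by_parts :
  \int[@leb2 R]_(z in Om) (F 0 z * Padj phi z) =
  \int[@leb2 R]_(z in Om) ((Ft z + F 1 z + F 3 z - F 5 z) * phi z).
Proof.
have cp i : continuous (p_ i) by exact: continuous_pder.
have cpt : continuous (dt phi) by exact: (@continuous_pder [:: true]).
(* The difference of the two integrands is the divergence of [(Ht, Hx)]. *)
pose Ht z := - (F 0 z * phi z).
pose Ht' z := - (Ft z * phi z + F 0 z * dt phi z).
pose Hx z := F 0 z * p_ 4 z - F 1 z * p_ 3 z + F 2 z * p_ 2 z - F 3 z * p_ 1 z +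
  F 4 z * p_ 0 z - (F 0 z * p_ 2 z - F 1 z * p_ 1 z + F 2 z * p_ 0 z) - F 0 z * p_ 0 z.
pose Hx' z := F 0 z * p_ 5 z + F 5 z * p_ 0 z - (F 0 z * p_ 3 z + F 3 z * p_ 0 z)
  - (F 1 z * p_ 0 z + F 0 z * p_ 1 z).
have cHt' : continuous Ht'.
  by apply: continuousN2; apply: continuousD2; apply: continuousM2 => //; exact: (cp 0%N).
have cFp i j : continuous (fun z => F i z * p_ j z) by apply: continuousM2.
have cHx' : continuous Hx'.
  by apply: continuousB2; [apply: continuousB2|]; apply: continuousD2.
have IHt : \int[@leb2 R]_(z in Om) Ht' z = 0.
  apply: (@integral_dt_eq0 Ht) => //.
  - move=> t x; have := is_derive_prod (dFt t x) (is_derive_phi_t t x).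
    exact: is_deriveN.
  - move=> x; have p0 : phi (a, x) = 0.
      by apply: (@pder_boundary [::]) => -[/= /andP[+ _] _]; rewrite ltxx.
    by rewrite /Ht p0 mulr0 oppr0.
  - move=> x; have p0 : phi (b, x) = 0.
      by apply: (@pder_boundary [::]) => -[/= /andP[_ +] _]; rewrite ltxx.
    by rewrite /Ht p0 mulr0 oppr0.
have IHx : \int[@leb2 R]_(z in Om) Hx' z = 0.
  apply: (@integral_dx_eq0 Hx) => //.
  - move=> t x.
    have dFp i j (i5 : (i < 5)%N) := is_derive_prod (dFx t x i5) (is_derive_pder_x j t x).
    have D4 := is_deriveD (is_deriveB (is_deriveD (is_deriveB (dFp 0%N 4%N isT)
      (dFp 1%N 3%N isT)) (dFp 2%N 2%N isT)) (dFp 3%N 1%N isT)) (dFp 4%N 0%N isT).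
    have D2 := is_deriveD (is_deriveB (dFp 0%N 2%N isT) (dFp 1%N 1%N isT)) (dFp 2%N 0%N isT).
    apply: (is_derive_eq (is_deriveB (is_deriveB D4 D2) (dFp 0%N 0%N isT))).
    rewrite /Hx' /=.
    move: (p_ 0 (t, x)) (p_ 1 (t, x)) (p_ 2 (t, x)) (p_ 3 (t, x)) (p_ 4 (t, x))
      (p_ 5 (t, x)) (F 0 (t, x)) (F 1 (t, x)) (F 2 (t, x)) (F 3 (t, x)) (F 4 (t, x))
      (F 5 (t, x)) => *; ring.
  - move=> t; have out j : p_ j (t, c) = 0.
      by apply: pder_boundary => -[/= _ /andP[+ _]]; rewrite ltxx.
    by rewrite /Hx !out !mulr0 !(addr0, subr0).
  - move=> t; have out j : p_ j (t, d) = 0.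
      by apply: pder_boundary => -[/= _ /andP[_ +]]; rewrite ltxx.
    by rewrite /Hx !out !mulr0 !(addr0, subr0).
have i1 := continuous_integrable_orect (continuousM2 (@cF 0%N) continuous_Padj).
have cG : continuous (fun z => (Ft z + F 1 z + F 3 z - F 5 z) * phi z).
  apply: continuousM2; last exact: (cp 0%N).
  by apply: continuousB2 => //; apply: continuousD2 => //; exact: continuousD2.
have i2 := continuous_integrable_orect cG.
have i3 := continuous_integrable_orect cHt'.
have i4 := continuous_integrable_orect cHx'.
apply/eqP; rewrite -subr_eq0; apply/eqP.
rewrite -RintegralB// -[RHS](addr0 0) -{1}IHt -IHx -RintegralD//.
apply: eq_Rintegral => z _.
rewrite /Ht' /Hx' /Padj /p_ /=.
exact: (by_parts_identity (dt phi z) (phi z) (dx phi z) (dx (dx (dx phi)) z)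
  (dx (dx (dx (dx (dx phi)))) z) (F 0 z) (F 1 z) (F 3 z) (F 5 z) (Ft z)).
Qed.

End IntegrationByParts.

(** * The entire extension *)

Lemma uphalf_addn_le m j : (uphalf (m + j) <= m + uphalf j)%N.
Proof. lia. Qed.

Section Extension.
Variable R : realType.
Local Notation mR := (measurableTypeR R).
Variables (W : nat -> nat -> R -> R) (B : R).
Implicit Types (k m N j : nat) (x t X : R) (z : R * R).
Hypothesis B0 : 0 <= B.
Hypothesis dW : forall k m t, is_derive t 1 (W k m) (W k.+1 m t).
Hypothesis eW : forall k m t,
  W k m.+4.+1 t = W k.+1 m t + W k m.+1 t + W k m.+3 t.
Hypothesis bW : forall k m t,
  `|W k m t| <= B * (4 ^+ k * 2 ^+ m * (2 * k + uphalf m)`!%:R).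

(* Formally [d_t^k d_x^m] of the Taylor series in [x] with coefficients [W 0 j t]. *)
Definition partial N k m z : R := taylor (fun j _ => W k (m + j)%N z.1) N z.2.

(** Each pair [(k, m)] has its own limit, that of the formally differentiated series; the
    differential relations are kept at the level of the partial sums. *)
Definition extension k m z : R := limn (fun N => partial N k m z).

(** The coefficient contributes [2 ^+ j] and the monomial [X ^+ j]; a further [2 ^+ j] is spent to
    obtain geometric decay, whence [coefseq] at [4 * X]. *)
Lemma coef_bound k m X : 0 <= X -> exists2 K, 0 <= K & forall j x, `|x| <= X ->
  B * (4 ^+ k * 2 ^+ (m + j) * (2 * k + uphalf (m + j))`!%:R) * (`|x| ^+ j / j`!%:R)
    <= K * 2^-1 ^+ j.
Proof.
move=> X0; have X40 : 0 <= 4 * X by rewrite mulr_ge0.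
have [K' K'P] := coefseq_bounded (2 * k + m) X40.
have K'0 : 0 <= K' by apply: le_trans (K'P 0%N); exact: coefseq_ge0.
exists (B * (4 ^+ k * 2 ^+ m) * K'); first by rewrite !mulr_ge0// exprn_ge0.
move=> j x xX.
apply: (@le_trans _ _ (B * (4 ^+ k * 2 ^+ m) * (coefseq (4 * X) (2 * k + m) j *
   2^-1 ^+ j))); last first.
  rewrite -[leRHS]mulrA ler_wpM2l//; first by rewrite !mulr_ge0// exprn_ge0.
  by rewrite ler_wpM2r// exprn_ge0.
have -> : B * (4 ^+ k * 2 ^+ (m + j) * (2 * k + uphalf (m + j))`!%:R) *
    (`|x| ^+ j / j`!%:R) = B * (4 ^+ k * 2 ^+ m) *
    (2 ^+ j * (2 * k + uphalf (m + j))`!%:R * (`|x| ^+ j / j`!%:R)).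
  by rewrite exprD; ring.
rewrite ler_wpM2l//; first by rewrite !mulr_ge0// exprn_ge0.
rewrite /coefseq.
have -> : (4 * X) ^+ j * (2 * k + m + uphalf j)`!%:R / j`!%:R * 2^-1 ^+ j =
    2 ^+ j * (2 * k + m + uphalf j)`!%:R * (X ^+ j / j`!%:R).
  have E : (4 * X) ^+ j * 2^-1 ^+ j = 2 ^+ j * X ^+ j.
    by rewrite -!exprMn; congr (_ ^+ _); field.
  by rewrite mulrAC [X in X / _]mulrAC E -!mulrA (mulrCA (X ^+ j)).
apply: ler_pM.
- by rewrite mulr_ge0// exprn_ge0.
- by rewrite divr_ge0// exprn_ge0.
- rewrite ler_wpM2l ?exprn_ge0// ler_nat; apply: leq_fact.
  by rewrite -addnA leq_add2l; exact: uphalf_addn_le.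
- by rewrite ler_wpM2r ?invr_ge0// lerXn2r ?nnegrE.
Qed.

Lemma term_bound k m X : 0 <= X -> exists2 K, 0 <= K & forall j z, `|z.2| <= X ->
  `|W k (m + j) z.1 * (z.2 ^+ j / j`!%:R)| <= K * 2^-1 ^+ j.
Proof.
move=> X0; have [K K0 KP] := coef_bound k m X0; exists K => // j z zX.
apply: le_trans (KP j _ zX); rewrite normrM normrM normfV normrX.
by rewrite (ger0_norm (ler0n _ j`!)) ler_wpM2r// divr_ge0// exprn_ge0.
Qed.

Lemma geometric_half_le (K : R) N : 0 <= K -> \sum_(j < N) K * 2^-1 ^+ j <= 2 * K.
Proof.
move=> K0; suff -> : \sum_(j < N) K * 2^-1 ^+ j = 2 * K - 2 * K * 2^-1 ^+ N.
  by rewrite gerBl mulr_ge0 ?mulr_ge0// exprn_ge0.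
elim: N => [|N IH]; first by rewrite big_ord0 expr0 mulr1 subrr.
by rewrite big_ord_recr/= IH exprS; field.
Qed.

Lemma partial_bound k m X : 0 <= X -> exists2 K, 0 <= K & forall N z, `|z.2| <= X ->
  `|partial N k m z| <= K.
Proof.
move=> X0; have [K K0 KP] := term_bound k m X0; exists (2 * K); first by rewrite mulr_ge0.
move=> N z zX; apply: le_trans (geometric_half_le N K0).
apply: (le_trans (ler_norm_sum _ _ _)); apply: ler_sum => j _; exact: KP.
Qed.

Lemma partial_cvg k m z : (fun N => partial N k m z) @ \oo --> extension k m z.
Proof.
pose u j := W k (m + j) z.1 * (z.2 ^+ j / j`!%:R).
have -> : (fun N => partial N k m z) = series u.
  by apply/funext => N; rewrite /partial /taylor /series/= big_mkord.
suff cu : cvgn (series u).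
  rewrite /extension (_ : (fun N => partial N k m z) = series u)//.
  by apply/funext => N; rewrite /partial /taylor /series/= big_mkord.
apply: normed_cvg; have [K K0 KP] := term_bound k m (normr_ge0 z.2).
apply: (@series_le_cvg _ _ (geometric K 2^-1)) => //.
- by move=> j; exact: normr_ge0.
- by move=> j; rewrite /geometric/= mulr_ge0// exprn_ge0.
- by move=> j; exact: KP.
- by apply: is_cvg_geometric_series; rewrite ger0_norm; lra.
Qed.

(** Exact for every [N], because all four sums have the same length and each term satisfies [eW].
    These are not the derivatives of one partial sum, since [d_x] shortens a sum by one term. *)
Lemma partial_eq N z :
  partial N 1 0 z + partial N 0 1 z + partial N 0 3 z - partial N 0 5 z = 0.
Proof.
rewrite /partial /taylor -!big_split/= -sumrB big1// => j _.
by rewrite (eW 0 j z.1); ring.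
Qed.

Lemma extension_eq z :
  extension 1 0 z + extension 0 1 z + extension 0 3 z - extension 0 5 z = 0.
Proof.
have h : (fun N => partial N 1 0 z + partial N 0 1 z + partial N 0 3 z -
    partial N 0 5 z) @ \oo -->
    extension 1 0 z + extension 0 1 z + extension 0 3 z - extension 0 5 z.
  by apply: cvgB; [apply: cvgD; [apply: cvgD|]|]; exact: partial_cvg.
rewrite -(cvg_lim _ h)//.
apply: (@lim_near_cst R^o) => //; apply: nearW => N; exact: partial_eq.
Qed.

Lemma extension_out k m z : (forall j, W k (m + j) z.1 = 0) -> extension k m z = 0.
Proof.
move=> W0; apply: (@lim_near_cst R^o) => //; apply: nearW => N.
by rewrite /partial /taylor big1// => j _; rewrite W0 mul0r.
Qed.

Lemma continuous_partial N k m : continuous (partial N k m).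
Proof.
rewrite /partial /taylor; elim: N => [|N IH].
  by under eq_fun do rewrite big_ord0; move=> z; exact: cvg_cst.
under eq_fun do rewrite big_ord_recr/=.
apply: continuousD2 => //; apply: continuousM2.
  move=> z; apply: (@continuous_comp _ _ _ fst (W k (m + N))); first exact: cvg_fst.
  exact: (continuous_is_derive (dW k (m + N))).
apply: continuousM2; last by move=> z; exact: cvg_cst.
move=> z; apply: (@continuous_comp _ _ _ snd (fun x : R => x ^+ N)); first exact: cvg_snd.
exact: exprn_continuous.
Qed.

Lemma is_derive_partial_t N k m t x :
  is_derive t 1 (fun s => partial N k m (s, x)) (partial N k.+1 m (t, x)).
Proof.
rewrite /partial /taylor /=.
have -> : (fun s => \sum_(j < N) W k (m + j) s * (x ^+ j / j`!%:R)) =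
    \sum_(j < N) (fun s => W k (m + j) s * (x ^+ j / j`!%:R)).
  by apply/funext => s; rewrite fct_sumE.
by apply: is_derive_sum => j; exact: is_derive_scaler.
Qed.

Lemma is_derive_partial_x N k m t x :
  is_derive x 1 (fun y => partial N.+1 k m (t, y)) (partial N k m.+1 (t, x)).
Proof.
apply: (is_derive_eq (is_derive_taylor (fun j _ => W k (m + j)%N t) N x)).
rewrite /partial /taylor; apply: eq_bigr => j _.
by rewrite /= addSnnS.
Qed.

Lemma measurable_extension k m (D : set (mR * mR)) : measurable D ->
  measurable_fun D (extension k m).
Proof.
move=> mD; apply: (@measurable_fun_cvg _ _ _ D (fun N => partial N k m)).
- by move=> N; apply: continuous_measurable2; exact: continuous_partial.
- by move=> z _; exact: partial_cvg.
Qed.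

Lemma extension_bound k m X : 0 <= X -> exists2 K, 0 <= K & forall z, `|z.2| <= X ->
  `|extension k m z| <= K.
Proof.
move=> X0; have [K K0 KP] := partial_bound k m X0; exists K => // z zX.
have h : (fun N => `|partial N k m z|) @ \oo --> `|extension k m z|.
  by apply: cvg_norm; exact: partial_cvg.
rewrite -(cvg_lim _ h)//.
apply: limr_le; first by apply/cvg_ex; eexists; exact: h.
by apply: nearW => N; exact: KP.
Qed.

Variables (a b c : R).
Hypotheses (ab : a < b) (c0 : 0 < c).
Let Om : set (mR * mR) := orect a b (- c) c.
Let mO : measurable Om. Proof. exact: measurable_orect. Qed.
Let fO : (@leb2 R Om < +oo)%E. Proof. exact: leb2_orect_lty. Qed.

Lemma Om_snd z : Om z -> `|z.2| <= c.
Proof. by move=> [_ /= /andP[h1 h2]]; rewrite ler_norml !ltW. Qed.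

Lemma inL2_extension k m : inL2 Om (extension k m).
Proof.
have mE := @measurable_extension k m Om mO.
split; first exact: mE.
have [K K0 KP] := extension_bound k m (ltW c0).
apply: (@le_lt_trans _ _ (\int[@leb2 R]_(z in Om) (K ^+ 2)%:E)%E).
  apply: ge0_le_integral_EFin => //.
    exact: measurable_funX.
  move=> z Oz; rewrite sqr_ge0/= -real_normK ?num_real// ler_sqr ?nnegrE//.
  by apply: KP; exact: Om_snd.
rewrite integral_cst//=; apply: lte_mul_pinfty => //; rewrite lee_fin; exact: sqr_ge0.
Qed.

(** The shift [N0] lets sums of different lengths be indexed by the same [N]; the partial sums are
    bounded uniformly in [N] on the rectangle. *)
Lemma integral_partial_cvg N0 k m (psi : R * R -> R) : continuous psi ->
  (fun N => \int[@leb2 R]_(z in Om) (partial (N + N0) k m z * psi z)) @ \oo -->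
  \int[@leb2 R]_(z in Om) (extension k m z * psi z).
Proof.
move=> cpsi.
have [K K0 KP] := partial_bound k m (ltW c0).
have [P PP] := continuous_bounded_orect a b (- c) c cpsi.
have P0 : 0 <= `|P| by [].
have mpsi : measurable_fun Om psi by exact: continuous_measurable2.
have mp N : measurable_fun Om (partial N k m).
  by apply: continuous_measurable2; exact: continuous_partial.
have [] := @dominated_convergence _ _ _ (@leb2 R) Om mO
  (fun N z => (partial (N + N0) k m z * psi z)%:E)
  (fun z => (extension k m z * psi z)%:E) (cst (K * `|P|)%:E).
- by move=> N; apply/measurable_EFinP; exact: measurable_funM.
- apply/measurable_EFinP; apply: measurable_funM => //.
  exact: measurable_extension.
- apply: aeW => z _; apply/fine_cvgP; split; first exact: nearW.
  apply: cvgM; last exact: cvg_cst.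
  have := @partial_cvg k m z.
  by move/(cvg_comp (fun N => (N + N0)%N) _ (cvg_addnr N0)).
- by apply: (@le_bounded_integrable _ _ _ (@leb2 R) Om mO fO (cst (K * `|P|)) (K * `|P|)) =>
   // z _; rewrite ger0_norm// mulr_ge0.
- apply: aeW => z N Oz; rewrite /= lee_fin normrM ler_pM//.
    by apply: KP; exact: Om_snd.
  exact: le_trans (PP z Oz) (ler_norm _).
move=> ie _; have -> : (\int[@leb2 R]_(z in Om) (extension k m z * psi z)%:E)%E =
    (\int[@leb2 R]_(z in Om) (extension k m z * psi z))%:E.
  by rewrite /Rintegral fineK//; exact: integrable_fin_num ie.
by move=> /fine_cvg.
Qed.

Lemma integrable_extension k m (psi : R * R -> R) : continuous psi ->
  (@leb2 R).-integrable Om (EFin \o (fun z => extension k m z * psi z)).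
Proof.
move=> cpsi; have [K K0 KP] := extension_bound k m (ltW c0).
have [P PP] := continuous_bounded_orect a b (- c) c cpsi.
apply: (@le_bounded_integrable _ _ _ (@leb2 R) Om mO fO _ (K * P)).
  apply: measurable_funM; first exact: measurable_extension.
  exact: continuous_measurable2.
by move=> z Oz; rewrite normrM ler_pM// ?PP//; apply: KP; exact: Om_snd.
Qed.

(** Integration by parts is exact for partial sums; the difference in lengths between its terms
    disappears in the limit, where [extension_eq] cancels the right-hand side. *)
Lemma Pzero_extension : Pzero Om (extension 0 0).
Proof.
move=> phi tphi.
have cphi : continuous phi by have [/(_ [::])[]] := tphi.
have cP := continuous_Padj tphi.
have cc : - c < c by have := c0; lra.
have byp N : \int[@leb2 R]_(z in Om) (partial (N + 5) 0 0 z * Padj phi z) =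
    \int[@leb2 R]_(z in Om) (partial (N + 5) 1 0 z * phi z) +
    \int[@leb2 R]_(z in Om) (partial (N + 4) 0 1 z * phi z) +
    \int[@leb2 R]_(z in Om) (partial (N + 2) 0 3 z * phi z) -
    \int[@leb2 R]_(z in Om) (partial (N + 0) 0 5 z * phi z).
  (* Starting from [N + 5] terms, [i] derivatives in [x] leave [N + (5 - i)], so the chain never
     runs below length [N]. *)
  have cF i : continuous (partial (N + (5 - i)) 0 i) by exact: continuous_partial.
  have cFt : continuous (partial (N + 5) 1 0) by exact: continuous_partial.
  have dFt t x := is_derive_partial_t (N + 5) 0 0 t x.
  have dFx i t x : (i < 5)%N -> is_derive x 1 (fun y => partial (N + (5 - i)) 0 i (t, y))
      (partial (N + (5 - i.+1)) 0 i.+1 (t, x)).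
    by move=> i5; rewrite -(subnSK i5) addnS; exact: is_derive_partial_x.
  have byp := @Padj_by_parts R a b (- c) c ab cc phi tphi
    (fun i => partial (N + (5 - i)) 0 i) (partial (N + 5) 1 0) cF cFt dFt dFx.
  transitivity (\int[@leb2 R]_(z in Om) ((partial (N + 5) 1 0 z + partial (N + 4) 0 1 z +
    partial (N + 2) 0 3 z - partial (N + 0) 0 5 z) * phi z)); first exact: byp.
  have ip M k m : (@leb2 R).-integrable Om (EFin \o (fun z => partial M k m z * phi z)).
    apply: continuous_integrable_orect; apply: continuousM2 => //.
    exact: continuous_partial.
  have i1 := ip (N + 5)%N 1%N 0%N; have i2 := ip (N + 4)%N 0%N 1%N.
  have i3 := ip (N + 2)%N 0%N 3%N; have i4 := ip (N + 0)%N 0%N 5%N.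
  have i12 : (@leb2 R).-integrable Om (EFin \o (fun z => partial (N + 5) 1 0 z * phi z +
      partial (N + 4) 0 1 z * phi z)).
    by rewrite /comp; under eq_fun do rewrite EFinD; exact: integrableD.
  have i123 : (@leb2 R).-integrable Om (EFin \o (fun z => partial (N + 5) 1 0 z * phi z +
      partial (N + 4) 0 1 z * phi z + partial (N + 2) 0 3 z * phi z)).
    by rewrite /comp; under eq_fun do rewrite EFinD; exact: integrableD.
  rewrite -RintegralD// -RintegralD// -RintegralB//.
  by apply: eq_Rintegral => z _; rewrite mulrBl !mulrDl.
have i0 := integrable_extension 0 0 cP.
have i1 := integrable_extension 1 0 cphi; have i2 := integrable_extension 0 1 cphi.
have i3 := integrable_extension 0 3 cphi; have i4 := integrable_extension 0 5 cphi.
suff : \int[@leb2 R]_(z in Om) (extension 0 0 z * Padj phi z) = 0.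
  by move=> E; rewrite -[RHS]/(0%:E) -E /Rintegral fineK//; exact: integrable_fin_num i0.
have lhs := @integral_partial_cvg 5 0 0 _ cP.
have rhs : (fun N => \int[@leb2 R]_(z in Om) (partial (N + 5) 0 0 z * Padj phi z)) @ \oo -->
    \int[@leb2 R]_(z in Om) (extension 1 0 z * phi z) +
    \int[@leb2 R]_(z in Om) (extension 0 1 z * phi z) +
    \int[@leb2 R]_(z in Om) (extension 0 3 z * phi z) -
    \int[@leb2 R]_(z in Om) (extension 0 5 z * phi z).
  under eq_fun do rewrite byp.
  by apply: cvgB; [apply: cvgD; [apply: cvgD|]|]; exact: integral_partial_cvg.
rewrite (cvg_unique _ lhs rhs)//.
have i12 : (@leb2 R).-integrable Om (EFin \o (fun z => extension 1 0 z * phi z +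
    extension 0 1 z * phi z)).
  by rewrite /comp; under eq_fun do rewrite EFinD; exact: integrableD.
have i123 : (@leb2 R).-integrable Om (EFin \o (fun z => extension 1 0 z * phi z +
    extension 0 1 z * phi z + extension 0 3 z * phi z)).
  by rewrite /comp; under eq_fun do rewrite EFinD; exact: integrableD.
rewrite -RintegralD// -RintegralD// -RintegralB//.
rewrite /Rintegral integral0_eq// => z _.
by rewrite -!mulrDl -mulrBl extension_eq mul0r.
Qed.

End Extension.

(** * Agreement of the extension with the mollified solution, and the final approximation *)

(** The estimate that makes the series converge also bounds the Taylor remainder of order [N] by a
    multiple of [2^-1 ^+ N], so the sum is the function itself and not merely a function with the
    same derivatives at 0. *)
Lemma extension_taylor (R : realType) (f : nat -> R * R -> R)
    (W : nat -> nat -> R -> R) (B X t : R) :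
  (forall m (x : R), is_derive x 1 (fun y : R => f m (t, y)) (f m.+1 (t, x))) ->
  (forall m, W 0%N m t = f m (t, 0)) ->
  0 <= B ->
  (forall m x, `|x| <= X -> `|f m (t, x)| <= B * (2 ^+ m * (uphalf m)`!%:R)) ->
  forall x, `|x| <= X -> extension W 0 0 (t, x) = f 0%N (t, x).
Proof.
move=> df Wf B0 fB x xX; have X0 := le_trans (normr_ge0 _) xX.
have [K K0 KP] := coef_bound B0 0 0 X0.
apply/cvg_lim => //; apply/cvgrPdist_le => e e0.
have : geometric K 2^-1 @ \oo --> (0 : R).
  by apply: cvg_geometric; rewrite ger0_norm; lra.
move=> /cvgrPdist_le /(_ _ e0); apply: filterS => N; rewrite sub0r normrN => KN.
have -> : partial W N 0 0 (t, x) = taylor (fun j y => f j (t, y)) N x.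
  by apply: eq_bigr => j _; rewrite /= Wf.
have H := @taylor_remainder R (fun j y => f j (t, y)) N
  (B * (2 ^+ N * (uphalf N)`!%:R)) X df (fB N) x xX.
apply: (le_trans H); apply: le_trans KN; apply: (le_trans _ (ler_norm _)).
by have := KP N x xX; rewrite expr0 mul1r.
Qed.

Lemma L2norm_lt (R : realType) (Om : set (R * R)) (u : R * R -> R) (e : R) : 0 < e ->
  (\int[@leb2 R]_(z in Om) ((u z) ^+ 2)%:E < (e ^+ 2)%:E)%E ->
  (L2norm Om u < e%:E)%E.
Proof.
move=> e0 ue; rewrite /L2norm.
have I0 : (0 <= \int[@leb2 R]_(z in Om) ((u z) ^+ 2)%:E)%E.
  by apply: integral_ge0 => z _; rewrite lee_fin sqr_ge0.
have IE : (\int[@leb2 R]_(z in Om) ((u z) ^+ 2)%:E =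
    (fine (\int[@leb2 R]_(z in Om) ((u z) ^+ 2)%:E))%:E)%E.
  by rewrite fineK// ge0_fin_numE// (lt_trans ue)// ltry.
move: I0 ue; rewrite {}IE; move: (fine _) => r; rewrite lee_fin lte_fin => r0 re.
rewrite poweR_EFin lte_fin powR12_sqrt// -[ltRHS](ger0_norm (ltW e0)) -sqrtr_sqr.
by rewrite ltr_sqrt// exprn_gt0.
Qed.

Theorem theorem1p2 (R : realType) (n : nat) (t1 t2 T : R) (u : R * R -> R)
  (eps : R) :
  (2 <= n)%N -> 0 < t1 -> t1 < t2 -> t2 < T ->
  inL2 (orect 0 T (- n%:R) n%:R) u ->
  Pzero (orect 0 T (- n%:R) n%:R) u ->
  supp_in (orect 0 T (- n%:R) n%:R)
          ([set z | t1 <= z.1 <= t2 /\ - n%:R < z.2 < n%:R]) u ->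
  0 < eps -> eps < Num.min t1 (T - t2) ->
  exists v : R * R -> R,
    [/\ inL2 (orect 0 T (- n.+1%:R) n.+1%:R) v,
        Pzero (orect 0 T (- n.+1%:R) n.+1%:R) v,
        supp_in (orect 0 T (- n.+1%:R) n.+1%:R)
          ([set z | t1 - eps <= z.1 <= t2 + eps /\ - n.+1%:R < z.2 < n.+1%:R]) v
      & (L2norm (orect 0 T (- n.-1%:R) n.-1%:R) (fun z => (v z - u z)%R)
          < eps%:E)%E].
Proof.
move=> n2 t10 t12 t2T [mu_ u2] Pu usupp eps0; rewrite lt_min => /andP[eps1 eps2].
set X : R := n%:R.
have XE : n.-1%:R = X - 1 :> R by rewrite /X -[in RHS](ltn_predK n2) -natr1 addrK.
have X2 : 2 <= X by rewrite /X ler_nat.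
set mR := measurableTypeR R.
pose Om : set (mR * mR) := orect 0 T (- X) X.
have mO : measurable Om by exact: measurable_orect.
have fO : (@leb2 R Om < +oo)%E by exact: leb2_orect_lty.
have muO : measurable_fun Om u by exact: mu_.
have iu : (@leb2 R).-integrable Om (EFin \o u) by exact: integrable_L2.
have e20 : 0 < eps ^+ 2 by rewrite exprn_gt0.
have [del1 del10 Hdel] := mollify_cvg_L2 muO u2 e20.
(* [del1] controls the [L^2] error. [eps / 3] gives [2 * del < eps], which leaves room before [t1]
   and after [t2] and keeps the time support within [eps]. [2^-1] places [|x| <= n - 1] inside the
   strip [|x| < n - del]. *)
pose del := Num.min del1 (Num.min (eps / 3) 2^-1).
have del0 : 0 < del by rewrite !lt_min del10 invr_gt0 ltr0n divr_gt0.
have delle : del <= del1 by rewrite ge_min lexx.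
have del3 : del <= eps / 3 by rewrite !ge_min lexx orbT.
have del2 : del <= 2^-1 by rewrite !ge_min lexx !orbT.
have [rho [C moll]] := exists_gevrey_mollifier del0.
have {}Hdel := Hdel del rho C del0 delle moll.
pose W k m t := mollify rho 0 T (- X) X u k m (t, 0).
pose B := mollify_cst C 0 T (- X) X u.
have t1a : 0 + 2 * del < t1 by lra.
have t2b : t2 + 2 * del < T by lra.
have bound k m (z : R * R) : - X + del < z.2 < X - del ->
    `|mollify rho 0 T (- X) X u k m z| <= B * (4 ^+ k * 2 ^+ m * (2 * k + uphalf m)`!%:R).
  exact: (mollify_gevrey_le del0 moll iu usupp Pu t1a t2b).
have X0 : - X + del < 0 < X - del by apply/andP; split; lra.
have B0 : 0 <= B.
  by have := le_trans (normr_ge0 _) (bound 0%N 0%N (0, 0) X0); rewrite !expr0 !mulr1.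
have dW k m (t : R) : is_derive t 1 (W k m) (W k.+1 m t).
  exact: (is_derive_mollify_t moll iu).
have eW k m t : W k m.+4.+1 t = W k.+1 m t + W k m.+1 t + W k m.+3 t.
  exact: (mollify_eq del0 moll iu usupp Pu t1a t2b).
have bW k m t : `|W k m t| <= B * (4 ^+ k * 2 ^+ m * (2 * k + uphalf m)`!%:R).
  exact: bound.
have T0 : 0 < T by lra.
have n10 : 0 < n.+1%:R :> R by [].
have out k m (z : R * R) : (z.1 <= t1 - del) || (t2 + del <= z.1) ->
    mollify rho 0 T (- X) X u k m z = 0.
  exact: (mollify_out del0 moll iu usupp).
have vout (z : R * R) : (z.1 <= t1 - del) || (t2 + del <= z.1) -> extension W 0 0 z = 0.
  by move=> zt; apply: extension_out => j; exact: out.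
exists (extension W 0 0); split.
- exact: (inL2_extension B0 dW bW).
- exact: (Pzero_extension B0 dW eW bW).
- apply: aeW => z Oz nz; apply: vout.
  have [//|] := boolP (_ || _).
  rewrite negb_or -!ltNge => /andP[h1 h2]; exfalso; apply: nz; split.
    by apply/andP; split; lra.
  by case: Oz.
apply: L2norm_lt => //.
rewrite XE.
pose Om' : set (mR * mR) := orect (0 + del) (T - del) (- X + del) (X - del).
pose inn : set (mR * mR) := orect 0 T (- (X - 1)) (X - 1).
have mO' : measurable Om' by exact: measurable_orect.
have minn : measurable inn by exact: measurable_orect.
have vE z : inn z -> extension W 0 0 z = mollify rho 0 T (- X) X u 0 0 z.
  case: z => t x [/= _ /andP[x1 x2]].
  have df m y := is_derive_mollify_x moll iu 0 m t y.
  have fB m y : `|y| <= X - 1 -> `|mollify rho 0 T (- X) X u 0 m (t, y)| <=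
      B * (2 ^+ m * (uphalf m)`!%:R).
    rewrite ler_norml => /andP[y1 y2].
    have := bound 0%N m (t, y); rewrite expr0 mul1r; apply.
    by apply/andP; split; rewrite /=; lra.
  have xX : `|x| <= X - 1 by rewrite ler_norml !ltW.
  exact: (@extension_taylor R (fun m => mollify rho 0 T (- X) X u 0 m) W B (X - 1) t
    df (fun m => erefl) B0 fB x xX).
pose f (z : R * R) := (mollify rho 0 T (- X) X u 0 0 z - u z) ^+ 2.
have innO : inn `<=` Om.
  by move=> z [/= /andP[h1 h2] /andP[h3 h4]]; split; apply/andP; split; rewrite /=; lra.
have O'O : Om' `<=` Om.
  by move=> z [/= /andP[h1 h2] /andP[h3 h4]]; split; apply/andP; split; rewrite /=; lra.
have mf : measurable_fun Om' (EFin \o f).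
  apply/measurable_EFinP; apply: measurable_funX; apply: measurable_funB.
    exact: (measurable_mollify moll).
  exact: measurable_funS muO.
have mfT : measurable_fun setT ((EFin \o f) \_ Om').
  exact/(measurable_restrictT _ _).1.
apply: le_lt_trans Hdel.
(* [inn] spans all of [(0, T)], whereas the error estimate holds on [Om'] only. The two differ in
   thin layers near times 0 and [T], where [v] is 0 and [u] is 0 almost everywhere, so the integrand
   may be cut off outside [Om']. *)
apply: (@le_trans _ _ (\int[@leb2 R]_(z in inn) ((EFin \o f) \_ Om') z)%E).
  rewrite le_eqVlt; apply/orP; left; apply/eqP.
  apply: ae_eq_integral => //.
  - apply/measurable_EFinP; apply: measurable_funX; apply: measurable_funB.
      exact: (measurable_extension B0 dW bW).
    exact: measurable_funS muO.
  - exact: measurable_funTS.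
  have aeF : Filter (almost_everywhere (@leb2 R)).
    exact: (@ae_filter_ringOfSetsType _ _ _ (@leb2 R)).
  move: usupp; apply: filterS => z /= uz iz.
  rewrite patchE; case: ifPn => zO' /=; first by rewrite vE.
  have zt : (z.1 <= del) || (T - del <= z.1).
    have [//|] := boolP (_ || _); rewrite negb_or -!ltNge => /andP[h1 h2].
    exfalso; move/negP : zO'; apply; rewrite inE; move: iz => [_ /= /andP[h3 h4]].
    by split; apply/andP; split; rewrite /= ?add0r//; lra.
  rewrite vout ?uz ?subrr ?expr0n//.
  - exact: innO.
  - by move=> [/= /andP[h1 h2] _]; move: zt => /orP[] ?; lra.
  - by move: zt => /orP[] ?; apply/orP; [left|right]; lra.
rewrite [leRHS]integral_mkcond; apply: ge0_subset_integral => //.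
by move=> z _; apply: erestrict_ge0 => w _; rewrite lee_fin sqr_ge0.
Qed.
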